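(* Let $G$ be a signed graph and $k$ a field. The edge ring $k[G]$ satisfies Serre's condition $R_1$ if and only if every facet subgraph $H$ of $G$ satisfies $\mathrm{comp}(H)\le\mathrm{comp}(G)+1$.
   Context: A signed graph $G$ on vertex set $\{1,\dots,n\}$ is a finite undirected graph, possibly with loops but without multiple edges, together with a sign function $\mathrm{sgn}:E(G)\to\{+1,-1\}$; an edge $ij$ of sign $\pm1$ is written $\pm ij$. For an edge $e=\pm ij$ put $\rho(e)=\mathrm{sgn}(e)(e_i+e_j)\in\mathbb{R}^n$ (a loop $ii$ gives $2\,\mathrm{sgn}(ii)e_i$). The edge ring is $k[G]=k[x^a : a\in\rho(E(G))]\subseteq k[x_1^{\pm1},\dots,x_n^{\pm1}]$, where $x^a=x_1^{a_1}\cdots x_n^{a_n}$; i.e. the semigroup ring of the semigroup generated by $\rho(E(G))$. A Noetherian ring $R$ satisfies $R_1$ if $R_\mathfrak{p}$ is regular for every prime $\mathfrak{p}$ with $\dim R_\mathfrak{p}\le1$. Subgraphs are spanning: a subgraph $H$ of $G$ has vertex set $\{1,\dots,n\}$ and a subset of the edges of $G$ with the same signs; $G\setminus H$ denotes the set of edges of $G$ not in $H$. A component is a maximal connected subgraph (an isolated vertex is a component); $\mathrm{comp}(\cdot)$ is the number of components. A component is bipartite if its vertex set can be partitioned into sets $L,R$ (one possibly empty) with every edge of the component having exactly one endpoint in each (a component with a loop is not bipartite). $\mathrm{bicomp}(\cdot)$ is the number of bipartite components. A subgraph $H$ of $G$ is a facet subgraph if (1) $\mathrm{bicomp}(H)=\mathrm{bicomp}(G)+1$,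 and (2) for any bipartite component $H'$ of $H$ which is not a component of $G$, there is a bipartition $V(H')=L\cup R$ such that every edge $e\in G\setminus H$ is either a positive edge with at least one endpoint in $L$ and no endpoint in $R$, or a negative edge with at least one endpoint in $R$ and no endpoint in $L$. *)

(* Defs.v *)
From HB Require Import structures.
From mathcomp Require Import all_boot all_order all_algebra.
Set Implicit Arguments. Unset Strict Implicit. Unset Printing Implicit Defensive.
Import Order.TTheory GRing.Theory Num.Theory.
Local Open Scope ring_scope.

(* Signed graphs on the vertex set 'I_n (= {1,...,n} shifted to 0-based). *)
(* A signed graph is encoded by s : 'I_n -> 'I_n -> int with            *)
(*   s i j = s j i,  s i j \in {-1,0,1};                                *)
(* s i j = 0 means "no edge ij", s i j = +1 / -1 means the edge +ij / -ij *)
(* (loops: i = j). At most one edge per pair (no multiple edges).       *)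

Definition signed_graph n (s : 'I_n -> 'I_n -> int) : bool :=
  [forall i, forall j, (s i j == s j i) && (s i j \in [:: -1; 0; 1])].

Definition subgraph n (s h : 'I_n -> 'I_n -> int) : bool :=
  [forall i, forall j, (h i j == h j i) && ((h i j == 0) || (h i j == s i j))].

Definition rho n (s : 'I_n -> 'I_n -> int) (i j : 'I_n) : 'rV[int]_n :=
  \row_(l < n) (s i j * ((l == i)%:R + (l == j)%:R)).

Definition in_semigroup n (s : 'I_n -> 'I_n -> int) (a : 'rV[int]_n) : Prop :=
  exists m : 'I_n -> 'I_n -> nat,
    a = \sum_(i < n) \sum_(j < n | (i <= j)%N) (rho s i j *+ m i j).

(* A is (a k-algebra isomorphic to) the edge ring k[G]: the semigroup   *)
(* ring of the semigroup generated by rho(E(G)), with monomials         *)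
(* x^a = e a.  Equivalently, the monomials x^a (a in S) form a k-basis  *)
(* of A and multiply by adding exponents.                              *)
Definition is_edge_ring (k : fieldType) n (s : 'I_n -> 'I_n -> int)
    (A : comAlgType k) (e : 'rV[int]_n -> A) : Prop :=
  [/\ e 0 = 1,
      (forall a b, in_semigroup s a -> in_semigroup s b -> e (a + b) = e a * e b),
      (forall l : seq ('rV[int]_n * k),
          uniq (map fst l) -> (forall p, p \in l -> in_semigroup s p.1) ->
          \sum_(p <- l) p.2 *: e p.1 = 0 -> forall p, p \in l -> p.2 = 0) &
      (forall x : A, exists l : seq ('rV[int]_n * k),
          (forall p, p \in l -> in_semigroup s p.1) /\
          x = \sum_(p <- l) p.2 *: e p.1)].

Definition is_ideal (R : comNzRingType) (I : R -> Prop) : Prop :=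
  [/\ I 0, (forall x y, I x -> I y -> I (x + y)) & (forall r x, I x -> I (r * x))].

Definition is_prime (R : comNzRingType) (P : R -> Prop) : Prop :=
  [/\ is_ideal P, ~ P 1 & (forall a b, P (a * b) -> P a \/ P b)].

Definition prime_chain (R : comNzRingType) (P : R -> Prop) (m : nat) : Prop :=
  exists Q : nat -> R -> Prop,
    [/\ (forall x, Q m x <-> P x),
        (forall i, (i <= m)%N -> is_prime (Q i)) &
        (forall i, (i < m)%N ->
           (forall x, Q i x -> Q i.+1 x) /\ exists x, Q i.+1 x /\ ~ Q i x)].

Definition height_eq (R : comNzRingType) (P : R -> Prop) (m : nat) : Prop :=
  prime_chain P m /\ ~ prime_chain P m.+1.

(* the elements of l (lying in P) generate the maximal ideal P R_P of R_P:
   every x/1 with x in P is an R_P-combination of the l_i/1, i.e.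
   u x lies in the ideal (l) of R for some u not in P. *)
Definition loc_generates (R : comNzRingType) (P : R -> Prop) (l : seq R) : Prop :=
  (forall a, a \in l -> P a) /\
  (forall x, P x -> exists u, ~ P u /\
     exists r : seq R, size r = size l /\
       u * x = \sum_(i < size l) r`_i * l`_i).

(* R_P is a regular local ring: its maximal ideal is minimally generated
   by exactly dim R_P elements. *)
Definition regular_at (R : comNzRingType) (P : R -> Prop) : Prop :=
  exists m, [/\ height_eq P m,
                (exists l, size l = m /\ loc_generates P l) &
                (forall l, loc_generates P l -> (m <= size l)%N)].

Definition serre_R1 (R : comNzRingType) : Prop :=
  forall P : R -> Prop, is_prime P ->
    (exists m, (m <= 1)%N /\ height_eq P m) -> regular_at P.

Definition adj n (h : 'I_n -> 'I_n -> int) : rel 'I_n := fun i j => h i j != 0.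

Definition compset n (h : 'I_n -> 'I_n -> int) (i : 'I_n) : {set 'I_n} :=
  [set j | connect (adj h) i j].

Definition comps n (h : 'I_n -> 'I_n -> int) : {set {set 'I_n}} :=
  [set compset h i | i : 'I_n].

Definition ncomp n (h : 'I_n -> 'I_n -> int) : nat := #|comps h|.

Definition bipartition n (h : 'I_n -> 'I_n -> int) (C L R : {set 'I_n}) : bool :=
  [&& L :|: R == C, L :&: R == set0 &
      [forall i, forall j, ((h i j != 0) && (i \in C)) ==>
          (((i \in L) && (j \in R)) || ((i \in R) && (j \in L)))]].

Definition bipartite_comp n (h : 'I_n -> 'I_n -> int) (C : {set 'I_n}) : bool :=
  [exists L, exists R, bipartition h C L R].

Definition nbicomp n (h : 'I_n -> 'I_n -> int) : nat :=
  #|[set C in comps h | bipartite_comp h C]|.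

Definition comp_of n (s h : 'I_n -> 'I_n -> int) (C : {set 'I_n}) : bool :=
  (C \in comps s) && [forall i, forall j, ((i \in C) && (j \in C)) ==> (s i j == h i j)].

Definition facet_subgraph n (s h : 'I_n -> 'I_n -> int) : bool :=
  [&& subgraph s h,
      nbicomp h == (nbicomp s).+1 &
      [forall C in comps h, (bipartite_comp h C && ~~ comp_of s h C) ==>
        [exists L, exists R, bipartition h C L R &&
          [forall i, forall j, ((s i j != 0) && (h i j == 0)) ==>
             (((s i j == 1) && ((i \in L) || (j \in L)) && (i \notin R) && (j \notin R))
           || ((s i j == -1) && ((i \in R) || (j \in R)) && (i \notin L) && (j \notin L)))]]]].

(* Main.v *)
Require Import Defs.
From HB Require Import structures.
From mathcomp Require Import all_boot all_order all_algebra.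
From mathcomp Require Import boolp zify ring.
Set Implicit Arguments. Unset Strict Implicit. Unset Printing Implicit Defensive.
Import Order.TTheory GRing.Theory Num.Theory.
Local Open Scope ring_scope.

(* A height-one prime P of k[G] either contains no monomial or is spanned by monomials. In the first case P becomes
   principal after localization, by pseudo-division with respect to a single exponent; this works for every semigroup
   ring and replaces the passage to Laurent polynomials and their unique factorization.
   In the second case the exponents outside P form a maximal proper face of the edge semigroup. By Farkas' lemma it
   has a supporting functional, the edges on it form a facet subgraph H, and each bipartite component C of H that is
   not a component of G yields the supporting functional sum_(i in L) a_i - sum_(i in R) a_i. The localization at P is
   a discrete valuation ring iff the edges outside H are multiples of one of them modulo the group W spanned by H.
   Membership in W is decided one component of H at a time (signed sum zero if bipartite, sum even otherwise), so this
   fails exactly when edges outside H join C to two different components. *)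

(** * Integer functionals and Farkas' lemma *)

Section Pairing.
Variable n : nat.
Implicit Types (v w : 'I_n -> int) (a b : 'rV[int]_n).

(** The edge ring need not be normal, so neither the height of a face ideal nor the number of its
    local generators can be read off from divisor theory. Both are settled by hand: primes of height
    one are handled as minimal nonzero primes, and being locally principal is stated with
    denominators cleared. The obstacle is the parity conditions in the description of [W], because
    of which two elements of the semigroup with equal values under all functionals need not be
    congruent. They act twice. To prove that a face ideal is a minimal prime, the elements of a
    smaller prime are first multiplied until all their exponents are even, and parities disappear.
    To prove that a face ideal is not locally principal, one parity has to tell apart two exponents
    of degree one. The constants 2 and 4 arise because the functional of [C] counts the endpoints in
    [C] of an edge outside [H], so that its values there are 1 and 2. *)

Definition dot v a : int := \sum_i v i * a ord0 i.

Lemma dotD v a b : dot v (a + b) = dot v a + dot v b.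
Proof. by rewrite -big_split; apply: eq_bigr => i _; rewrite mxE mulrDr. Qed.

Lemma dot0 v : dot v 0 = 0.
Proof. by rewrite /dot big1 // => i _; rewrite mxE mulr0. Qed.

Lemma dotN v a : dot v (- a) = - dot v a.
Proof. by apply/eqP; rewrite -addr_eq0 -dotD addNr dot0. Qed.

Lemma dotMz v a z : dot v (a *~ z) = dot v a * z.
Proof.
have H m : dot v (a *+ m) = dot v a * m%:Z.
  elim: m => [|m IH]; first by rewrite mulr0n dot0 mulr0.
  by rewrite mulrS dotD IH; lia.
by case: z => m; rewrite ?NegzE ?mulrNz -?pmulrn ?dotN H //; lia.
Qed.

Lemma dotMn v a m : dot v (a *+ m) = dot v a * m%:Z.
Proof. by rewrite pmulrn dotMz. Qed.

Lemma dot_comb v w p q a : dot (fun i => p * v i - q * w i) a = p * dot v a - q * dot w a.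
Proof.
rewrite !mulr_sumr -sumrB; apply: eq_bigr => i _; ring.
Qed.

Lemma dot_oppl v a : dot (fun i => - v i) a = - dot v a.
Proof. by rewrite -sumrN; apply: eq_bigr => i _; rewrite mulNr. Qed.

Lemma dot_delta v i : dot v (delta_mx ord0 i) = v i.
Proof.
rewrite /dot (bigD1 i) //= mxE !eqxx mulr1 big1 ?addr0 // => j ji.
by rewrite mxE (negPf ji) andbF mulr0.
Qed.

Lemma rhoE (s : 'I_n -> 'I_n -> int) i j :
  rho s i j = (delta_mx ord0 i + delta_mx ord0 j) *~ s i j.
Proof.
by apply/rowP => l; rewrite -scaler_int !mxE !eqxx intz.
Qed.

Lemma dot_rho v (s : 'I_n -> 'I_n -> int) i j : dot v (rho s i j) = s i j * (v i + v j).
Proof. by rewrite rhoE dotMz dotD !dot_delta mulrC. Qed.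

(* Bartl's inductive proof of Farkas' lemma, without division: K plays the role of the cone spanned by l. *)
Lemma farkas (K : 'rV[int]_n -> Prop) (l : seq 'rV[int]_n) g :
  K 0 -> (forall a b, K a -> K b -> K (a + b)) -> (forall a, a \in l -> K a) ->
  (forall v, (forall a, a \in l -> dot v a <= 0) -> dot v g <= 0) ->
  exists2 N : nat, (0 < N)%N & K (g *+ N).
Proof.
move=> K0 KD; have KX a m : K a -> K (a *+ m).
  by move=> Ka; elim: m => [|m IH]; rewrite ?mulr0n // mulrS; exact: KD.
have KZ a z : 0 <= z -> K a -> K (a *~ z) by case: z => // m _ /KX; exact.
have [m] := ubnP (size l); elim: m l g => // m IH [|a0 l] g /= lm Kl Hl.
  exists 1%N => //; rewrite mulr1n; suff -> : g = 0 by [].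
  (* Without generators every functional is admissible, and [g] itself gives a sum of squares that
     is at most 0. *)
  have /Hl : forall a, a \in [::] -> dot (g ord0) a <= 0 by [].
  rewrite le_eqVlt ltNge sumr_ge0 ?orbF; last by move=> i _; rewrite -expr2 sqr_ge0.
  rewrite psumr_eq0 => [/allP H|i _]; last by rewrite -expr2 sqr_ge0.
  apply/rowP => i; have := H i (mem_index_enum i); rewrite mulf_eq0 orbb => /eqP ->.
  by rewrite mxE.
have [Hl'|] := pselect (forall v, (forall a, a \in l -> dot v a <= 0) -> dot v g <= 0).
  by apply: IH Hl' => // a al; apply: Kl; rewrite inE al orbT.
move=> /existsNP [x /not_implyP [xl /negP]]; rewrite -ltNge => xg.
set p := dot x a0.
have p0 : 0 < p.
  rewrite ltNge; apply/negP => xp; have := Hl x; rewrite leNgt xg => H.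
  suff : false by []; apply: H => a; rewrite inE => /predU1P[->//|]; exact: xl.
(* Projection along [a0] to the hyperplane where [x] vanishes, times [p] to stay integral. As [x] is
   nonpositive on [l], it maps [l] into the cone; its adjoint turns [v] into a functional vanishing
   at [a0]. *)
pose T a := a *~ p - a0 *~ dot x a.
have dT v a : dot v (T a) = dot (fun i => p * v i - dot v a0 * x i) a.
  by rewrite dot_comb dotD dotN !dotMz; lia.
have Ka0 : K a0 by apply: Kl; exact: mem_head.
have [|||N N0 KN] := IH (map T l) (T g).
- by rewrite size_map.
- move=> _ /mapP [a al ->]; rewrite /T -mulrNz; apply: KD; apply: KZ => //; first lia.
    by apply: Kl; rewrite inE al orbT.
  by have := xl a al; lia.
- move=> v Hv; rewrite dT; apply: Hl => a; rewrite inE => /predU1P[->|al].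
    by rewrite dot_comb -/p; lia.
  by rewrite -dT; apply: Hv; exact: map_f.
exists (absz p * N)%N; first by lia.
have -> : g *+ (absz p * N) = T g *+ N + a0 *~ (dot x g * N%:Z).
  by rewrite /T mulrnBl !pmulrn -!mulrzA subrK PoszM gtz0_abs.
by apply: KD => //; apply: KZ => //; rewrite mulr_ge0 // ltW.
Qed.

End Pairing.

(** * Components and the lattice spanned by the edges *)

Section Components.
Variables (n : nat) (h : 'I_n -> 'I_n -> int).
Hypothesis hS : forall i j, h i j = h j i.

Lemma connect_adj_ind (K : 'I_n -> Prop) i j :
  (forall u v, h u v != 0 -> K u -> K v) -> connect (adj h) i j -> K i -> K j.
Proof.
move=> HK /connectP [p pth ->]; elim: p i pth => //= u p IH i /andP[iu up] Ki.
by apply: IH up _; exact: HK iu Ki.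
Qed.

Lemma connect_adj_sym : connect_sym (adj h).
Proof. by apply: sym_connect_sym => i j; rewrite /adj hS. Qed.

Lemma compset_refl i : i \in compset h i.
Proof. by rewrite inE connect0. Qed.

Lemma compset_eq i j : j \in compset h i -> compset h j = compset h i.
Proof.
rewrite inE => ij; apply/setP => l; rewrite !inE.
by rewrite (same_connect connect_adj_sym ij).
Qed.

Lemma mem_comps i : compset h i \in comps h.
Proof. exact: imset_f. Qed.

Lemma comps_mem C i : C \in comps h -> i \in C -> C = compset h i.
Proof. by move=> /imsetP [r _ ->] /compset_eq ->. Qed.

Lemma comps_ex C : C \in comps h -> exists2 i, i \in C & C = compset h i.
Proof. by move=> /imsetP [r _ ->]; exists r => //; exact: compset_refl. Qed.

Lemma comps_eq C D i : C \in comps h -> D \in comps h -> i \in C -> i \in D -> C = D.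
Proof. by move=> Ch Dh iC iD; rewrite (comps_mem Ch iC) (comps_mem Dh iD). Qed.

Lemma comps_closed C i j : C \in comps h -> h i j != 0 -> (i \in C) = (j \in C).
Proof.
move=> /imsetP [r _ ->] hij; rewrite !inE.
exact: (same_connect1r connect_adj_sym (hij : adj h i j)).
Qed.

(** These are the functionals that vanish on the edges of [h]. They are zero on nonbipartite
    components and a constant times the difference of the two sides on a bipartite one. *)
Definition balanced (v : 'I_n -> int) := forall i j, h i j != 0 -> v i + v j = 0.

(** Both factors change sign along an edge, so their product does not. With [v = w] this bounds a
    balanced functional up to sign; in general it expresses proportionality without division. *)
Lemma balanced_mul_const v w i j : balanced v -> balanced w -> j \in compset h i ->
  v j * w j = v i * w i.
Proof.
move=> bv bw; rewrite inE => ij.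
apply: (connect_adj_ind (K := fun j => v j * w j = v i * w i) _ ij) => // u u' uu' <-.
have -> : v u' = - v u by have := bv _ _ uu'; lia.
have -> : w u' = - w u by have := bw _ _ uu'; lia.
by rewrite mulrNN.
Qed.

Lemma balanced_bipartite v r : balanced v -> v r != 0 -> bipartite_comp h (compset h r).
Proof.
move=> bv vr; have H i : i \in compset h r -> v i = v r \/ v i = - v r.
  move=> ir; have := balanced_mul_const bv bv ir => /eqP.
  by rewrite -!expr2 eqf_sqr => /orP[/eqP|/eqP]; [left|right].
apply/existsP; exists [set i in compset h r | v i == v r].
apply/existsP; exists [set i in compset h r | v i == - v r].
apply/and3P; split.
- apply/eqP/setP => i; rewrite !inE; case: (boolP (connect _ _ _)) => //= ir.
  by case: (H i); rewrite ?inE // => ->; rewrite eqxx ?orbT.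
- apply/eqP/setP => i; rewrite !inE; apply/negP => /andP[/andP[_ /eqP ->] /andP[_]]; lia.
apply/forallP => i; apply/forallP => j; apply/implyP => /andP[hij ir].
have jr : j \in compset h r by rewrite -(comps_closed (mem_comps r) hij).
have := bv _ _ hij; rewrite !in_set -!/(compset _ _); move: (ir) (jr); rewrite !in_set => -> -> /=.
case: (H i ir) => ->; lia.
Qed.

Definition sgv (L R : {set 'I_n}) i : int := (i \in L)%:R - (i \in R)%:R.

Lemma bipartition_sgv C L R : C \in comps h -> bipartition h C L R ->
  [/\ balanced (sgv L R), forall i, (sgv L R i != 0) = (i \in C),
      forall i, -1 <= sgv L R i <= 1 & forall i, (i \in L) = (sgv L R i == 1) /\ (i \in R) = (sgv L R i == -1)].
Proof.
move=> Ch /and3P[/eqP LR /eqP LI /forallP HE].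
have dis i : ~~ ((i \in L) && (i \in R)) by rewrite -in_setI LI inE.
have cov i : (i \in C) = (i \in L) || (i \in R) by rewrite -LR inE.
split.
- move=> i j hij; have := comps_closed Ch hij.
  have /forallP /(_ j) := HE i; rewrite hij /= /sgv => /implyP H E.
  have := dis i; have := dis j; have := cov i; have := cov j; move: H; rewrite E.
  by case: (j \in C); do ! case: (_ \in _) => //=; move=> /(_ isT).
- by move=> i; have := dis i; rewrite cov /sgv; do ! case: (_ \in _).
- by move=> i; rewrite /sgv; do ! case: (_ \in _).
- by move=> i; have := dis i; rewrite /sgv; do ! case: (_ \in _).
Qed.

Lemma sgv_bipartition C g : C \in comps h -> balanced g -> (forall i, (g i != 0) = (i \in C)) ->
  (forall i, -1 <= g i <= 1) -> bipartition h C [set i | g i == 1] [set i | g i == -1].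
Proof.
move=> Ch bg gC g1; apply/and3P; split.
- by apply/eqP/setP => i; rewrite !inE -gC; have := g1 i; lia.
- by apply/eqP/setP => i; rewrite !inE; lia.
apply/forallP => i; apply/forallP => j; apply/implyP => /andP[hij]; rewrite !inE -gC.
by have := bg _ _ hij; have := g1 i; lia.
Qed.

(* K is meant to be the group spanned by the vectors of the edges of h. *)
Lemma edge_lattice (K : 'rV[int]_n -> Prop) a :
  K 0 -> (forall b c, K b -> K c -> K (b + c)) -> (forall b, K b -> K (- b)) ->
  (forall i j, h i j != 0 -> K (delta_mx ord0 i + delta_mx ord0 j)) ->
  (forall C L R, C \in comps h -> bipartition h C L R -> dot (sgv L R) a = 0) ->
  (forall C, C \in comps h -> ~~ bipartite_comp h C -> (2 %| (\sum_(i in C) a ord0 i)%R)%Z) ->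
  K a.
Proof.
move=> K0 KD KN Kh Hb Hn.
have KB b c : K b -> K c -> K (b - c) by move=> Kb Kc; apply: KD => //; exact: KN.
have KX b m : K b -> K (b *+ m).
  by move=> Kb; elim: m => [|m IH]; rewrite ?mulr0n // mulrS; exact: KD.
have KZ b z : K b -> K (b *~ z).
  by move=> Kb; case: z => m; rewrite ?NegzE ?mulrNz -?pmulrn; [exact: KX | exact/KN/KX].
have A1 (x y z : 'rV[int]_n) : (x + y) - (x - z) = y + z.
  by rewrite opprB [x + y]addrC -addrA [z - x]addrC addNKr.
have A2 (x y z : 'rV[int]_n) : (x + y) - (x + z) = y - z.
  by rewrite opprD [x + y]addrC -addrA addNKr.
pose dl i : 'rV[int]_n := delta_mx ord0 i.
rewrite (row_sum_delta a) (partition_big (compset h) (mem (comps h))) /=; last first.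
  by move=> i _; exact: mem_comps.
apply: (big_ind K) => // C Ch.
have [r rC EC] := comps_ex Ch.
have Esum : \sum_(i | compset h i == C) a 0 i *: delta_mx 0 i = \sum_(i in C) dl i *~ a ord0 i.
  apply: eq_big => i; first by apply/eqP/idP => [<-|/(comps_mem Ch) //]; exact: compset_refl.
  by rewrite -scaler_int intz.
rewrite Esum.
(* Modulo [K] each basis vector of the component is a multiple [g i] of the one at the base point
   [r], so the part of [a] on [C] becomes a single multiple of [dl r]. *)
suff [g [Kg Kr]] : exists g : 'I_n -> int, (forall i, i \in C -> K (dl i - dl r *~ g i)) /\
    K (dl r *~ \sum_(i in C) g i * a ord0 i).
  have -> : \sum_(i in C) dl i *~ a ord0 i =
      \sum_(i in C) (dl i - dl r *~ g i) *~ a ord0 i + dl r *~ \sum_(i in C) g i * a ord0 i.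
    rewrite mulrz_sumr -big_split /=; apply: eq_bigr => i _.
    by rewrite mulrzBl mulrzA subrK.
  by apply: (KD) => //; apply: (big_ind K) => // i iC; apply: KZ; exact: Kg.
have [/existsP [L /existsP [R LR]]|nb] := boolP (bipartite_comp h C).
  have [bg gC g1 _] := bipartition_sgv Ch LR; set g := sgv L R in bg gC g1.
  exists (fun i => g i * g r); split=> [i|]; last first.
    have -> : \sum_(i in C) g i * g r * a ord0 i = g r * dot g a.
      rewrite /dot mulr_sumr big_mkcond; apply: eq_bigr => i _; case: ifP; first by move=> _; ring.
      by rewrite -gC => /negbFE /eqP ->; rewrite mul0r mulr0.
    by rewrite (Hb C) // mulr0 mulr0z.
  rewrite EC inE => /(connect_adj_ind (K := fun i => K (dl i - dl r *~ (g i * g r)))); apply.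
    move=> u v huv Ku; have -> : g v = - g u by have := bg _ _ huv; lia.
    have -> : dl v - dl r *~ (- g u * g r) = (dl u + dl v) - (dl u - dl r *~ (g u * g r)).
      by rewrite mulNr mulrNz opprK A1.
    by apply: KB => //; exact: Kh.
  have -> : g r * g r = 1 by have := gC r; rewrite rC; have := g1 r; nia.
  by rewrite mulr1z subrr.
(* Modulo [K] each [dl i] is [dl r] or [- dl r]. If these two were different classes, the sign would
   be a 2-colouring of the component. *)
have K2 : K (dl r *+ 2).
  apply: contrapT => nK2; case/negP: nb; rewrite EC.
  pose v i : int := if `[< K (dl i - dl r)>] then 1 else -1.
  have dich i : i \in C -> K (dl i - dl r) \/ K (dl i + dl r).
    rewrite EC inE => /(connect_adj_ind (K := fun i => K (dl i - dl r) \/ K (dl i + dl r))); apply.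
      move=> u w huw [Ku|Ku]; [right|left].
        have -> : dl w + dl r = (dl u + dl w) - (dl u - dl r) by rewrite A1.
        by apply: KB => //; exact: Kh.
      have -> : dl w - dl r = (dl u + dl w) - (dl u + dl r) by rewrite A2.
      by apply: KB => //; exact: Kh.
    by left; rewrite subrr.
  have excl i : K (dl i - dl r) -> K (dl i + dl r) -> False.
    move=> H1 H2; apply: nK2; have -> : dl r *+ 2 = (dl i + dl r) - (dl i - dl r).
      by rewrite A1.
    exact: KB.
  pose w i : int := if i \in C then v i else 0.
  apply: (@balanced_bipartite w); last by rewrite /w rC /v; case: asboolP.
  move=> i j hij; rewrite /w (comps_closed Ch hij); case: ifP => // jC.
  have iC : i \in C by rewrite (comps_closed Ch hij).
  rewrite /v; case: asboolP => Ki; case: asboolP => Kj //.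
    case: (excl j Kj); have -> : dl j + dl r = (dl i + dl j) - (dl i - dl r).
      by rewrite A1.
    by apply: KB => //; exact: Kh.
  have [//|Ki'] := dich i iC; case: Kj.
  have -> : dl j - dl r = (dl i + dl j) - (dl i + dl r) by rewrite A2.
  by apply: KB => //; exact: Kh.
(* Since [dl r *+ 2] lies in [K], signs no longer matter and an even sum vanishes modulo [K]. *)
exists (fun=> 1); split=> [i|]; last first.
  under eq_bigr do rewrite mul1r.
  by have /dvdzP [q ->] := Hn C Ch nb; rewrite mulrC mulrzA -[dl r *~ 2]/(dl r *+ 2); exact: KZ.
rewrite EC inE => /(connect_adj_ind (K := fun i => K (dl i - dl r *~ 1))); apply; last first.
  by rewrite mulr1z subrr.
move=> u v huv; rewrite !mulr1z => Ku.
have -> : dl v - dl r = (dl u + dl v) - (dl u - dl r) - dl r *+ 2.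
  by rewrite A1 mulr2n opprD addrA addrK.
by apply: (KB) => //; apply: KB => //; exact: Kh.
Qed.

End Components.

(** * Facet subgraphs *)

Section Cuts.
Variables (n : nat) (s h : 'I_n -> 'I_n -> int).
Hypotheses (sG : signed_graph s) (hsub : subgraph s h).

Lemma signed_sym i j : s i j = s j i.
Proof. by have /forallP/(_ i)/forallP/(_ j)/andP[/eqP] := sG. Qed.

Lemma signed_val i j : s i j != 0 -> s i j = 1 \/ s i j = -1.
Proof.
have /forallP/(_ i)/forallP/(_ j)/andP[_] := sG; rewrite !inE => /or3P[/eqP->|/eqP->|/eqP->] //.
  by right.
by left.
Qed.

Lemma sub_sym i j : h i j = h j i.
Proof. by have /forallP/(_ i)/forallP/(_ j)/andP[/eqP] := hsub. Qed.

Lemma sub_val i j : h i j != 0 -> h i j = s i j.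
Proof.
by have /forallP/(_ i)/forallP/(_ j)/andP[_ /orP[/eqP->|/eqP->//]] := hsub; rewrite eqxx.
Qed.

Lemma sub_neq0 i j : h i j != 0 -> s i j != 0.
Proof. by move=> hij; rewrite -sub_val. Qed.

Lemma compset_sub i j : j \in compset h i -> j \in compset s i.
Proof.
rewrite !inE => ij; apply: (connect_adj_ind (K := fun j => connect (adj s) i j) _ ij) => // u v huv iu.
exact: connect_trans iu (connect1 (sub_neq0 huv)).
Qed.

Lemma compset_step i u v : s u v != 0 -> u \in compset s i -> v \in compset s i.
Proof. by rewrite !inE => suv iu; exact: connect_trans iu (connect1 suv). Qed.

Lemma balanced_sub v : balanced s v -> balanced h v.
Proof. by move=> bv i j /sub_neq0; exact: bv. Qed.

(* In the notation of the definition of a facet subgraph, g is 1 on L, -1 on R and 0 elsewhere. *)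
Definition cut C (g : 'I_n -> int) :=
  [/\ C \in comps h, balanced h g, forall i, (g i != 0) = (i \in C), forall i, -1 <= g i <= 1 &
      forall i j, s i j != 0 -> h i j = 0 -> 0 < s i j * (g i + g j)].

(** For values in -1, 0, 1 the sum [g i + g j] is positive exactly when an endpoint lies in [L] and
    none in [R]. Hence the two cases of the definition merge into one: the functional is positive on
    every removed edge. *)
Lemma cutP C : C \in comps h ->
  reflect (exists g, cut C g)
    [exists L : {set 'I_n}, exists R : {set 'I_n}, bipartition h C L R &&
      [forall i, forall j, ((s i j != 0) && (h i j == 0)) ==>
         (((s i j == 1) && ((i \in L) || (j \in L)) && (i \notin R) && (j \notin R))
       || ((s i j == -1) && ((i \in R) || (j \in R)) && (i \notin L) && (j \notin L)))]].
Proof.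
move=> Ch; apply: (iffP existsP) => [[L /existsP [R /andP[LR /forallP H]]]|[g [_ bg gC g1 gpos]]].
  have [bg gC g1 gLR] := bipartition_sgv sub_sym Ch LR.
  exists (sgv L R); split=> // i j sij hij; have /forallP /(_ j) := H i.
  rewrite sij hij eqxx /=; have [-> ->] := gLR i; have [-> ->] := gLR j.
  have := g1 i; have := g1 j; have [->|->] := signed_val sij; lia.
exists [set i | g i == 1]; apply/existsP; exists [set i | g i == -1].
rewrite (sgv_bipartition Ch bg gC g1) /=; apply/forallP => i; apply/forallP => j.
apply/implyP => /andP[sij /eqP hij]; rewrite !inE; have := gpos i j sij hij.
have := g1 i; have := g1 j; have [->|->] := signed_val sij; lia.
Qed.

Definition is_new C := [&& C \in comps h, bipartite_comp h C & ~~ comp_of s h C].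

Lemma facet_subgraphP : facet_subgraph s h <->
  nbicomp h = (nbicomp s).+1 /\ forall C, is_new C -> exists g, cut C g.
Proof.
rewrite /facet_subgraph hsub /=; split=> [/andP[/eqP -> /forallP H]|[-> H]].
  split=> // C /and3P[Ch bC nC]; apply/cutP => //.
  by have := H C; rewrite Ch bC nC.
rewrite eqxx /=; apply/forallP => C; apply/implyP => Ch; apply/implyP => /andP[bC nC].
by apply/cutP => //; apply: H; rewrite /is_new Ch bC.
Qed.

Lemma comp_of_step C i j : comp_of s h C -> i \in C -> s i j != 0 -> j \in C /\ h i j = s i j.
Proof.
case/andP=> Cs /forallP H iC sij.
have jC : j \in C by rewrite -(comps_closed signed_sym Cs sij).
by split=> //; have /forallP /(_ j) := H i; rewrite iC jC => /eqP.
Qed.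

Lemma bipartite_comp_of C : comp_of s h C -> bipartite_comp h C -> bipartite_comp s C.
Proof.
move=> Cold /existsP [L /existsP [R /and3P[HL HR /forallP HE]]].
apply/existsP; exists L; apply/existsP; exists R.
apply/and3P; split=> //; apply/forallP => i; apply/forallP => j; apply/implyP => /andP[sij iC].
have [_ hij] := comp_of_step Cold iC sij.
by have /forallP /(_ j) := HE i; rewrite hij sij iC.
Qed.

Lemma compset_leave C i j : C \in comps h -> i \in C -> j \notin C -> connect (adj s) i j ->
  exists u v, [/\ u \in C, v \notin C, s u v != 0 & h u v = 0].
Proof.
move=> Ch iC jC ij; apply: contrapT => H; case/negP: jC.
apply: (connect_adj_ind (K := fun j => j \in C) _ ij) => // u v suv uC.
apply: contrapT => /negP vC; apply: H; exists u, v; split=> //.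
by apply/eqP/negPn/negP => huv; move: vC; rewrite -(comps_closed sub_sym Ch huv) uC.
Qed.

(** A path of [s] leaving [C] would cross a removed edge. *)
Lemma comp_of_all C : C \in comps h -> (forall i j, i \in C -> s i j != 0 -> h i j != 0) -> comp_of s h C.
Proof.
move=> Ch H; have [r rC EC] := comps_ex Ch.
have Cs : C = compset s r.
  apply/setP => j; apply/idP/idP => [|jr]; first by rewrite EC; exact: compset_sub.
  apply: contrapT => /negP jC; have rj : connect (adj s) r j by move: jr; rewrite inE.
  have [u [v [uC vC suv huv]]] := compset_leave Ch rC jC rj.
  by have := H u v uC suv; rewrite huv eqxx.
rewrite /comp_of {1}Cs mem_comps /=; apply/forallP => i; apply/forallP => j.
apply/implyP => /andP[iC jC]; have [/eqP hij|hij] := boolP (h i j == 0); last by rewrite sub_val.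
by rewrite hij; apply/negPn/negP => sij; have := H i j iC; rewrite hij eqxx => /(_ sij).
Qed.

Section OneCut.
Variables (C : {set 'I_n}) (g : 'I_n -> int).
Hypothesis Cg : cut C g.

(** Positivity excludes opposite signs at the two ends, so the value is the number of endpoints in
    [C], a loop counting twice. *)
Lemma cut_val i j : s i j != 0 -> h i j = 0 -> s i j * (g i + g j) = (i \in C)%:R + (j \in C)%:R.
Proof.
case: Cg => Ch bg gC g1 gpos sij hij; have := gpos i j sij hij.
rewrite -!gC; have := g1 i; have := g1 j; have [->|->] := signed_val sij; lia.
Qed.

Lemma cut_val0 i j : h i j != 0 -> s i j * (g i + g j) = 0.
Proof. by case: Cg => _ bg _ _ _ /bg ->; rewrite mulr0. Qed.

Lemma cut_ge0 i j : 0 <= s i j * (g i + g j).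
Proof.
have [->|sij] := eqVneq (s i j) 0; first by rewrite mul0r.
have [hij|hij] := eqVneq (h i j) 0; last by rewrite cut_val0.
by rewrite cut_val // addr_ge0.
Qed.

Lemma cut_touch i j : s i j != 0 -> h i j = 0 -> (i \in C) || (j \in C).
Proof.
move=> sij hij; have [_ _ _ _ /(_ i j sij hij)] := Cg; rewrite cut_val //.
by case: (i \in C); case: (j \in C).
Qed.

(** Pigeonhole: of the components of [h] other than [C], two lie in the same component of [s]. Each
    of them is left by a removed edge, whose other end must be in [C] because every removed edge
    touches [C]. *)
Lemma cut_leave_many : (ncomp s + 2 <= ncomp h)%N ->
  exists D1 D2 u1 v1 u2 v2, [/\ [/\ D1 \in comps h, D2 \in comps h, D1 != C, D2 != C & D1 != D2],
    [/\ u1 \in D1, v1 \in C & s u1 v1 != 0] & [/\ u2 \in D2, v2 \in C & s u2 v2 != 0]].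
Proof.
case: (Cg) => Ch _ _ _ _ cnt.
pose f (D : {set 'I_n}) := \bigcup_(x in D) compset s x.
have fE D x : D \in comps h -> x \in D -> f D = compset s x.
  move=> Dh xD; apply/setP => y; apply/bigcupP/idP => [[z zD]|yx]; last by exists x.
  suff -> : compset s z = compset s x by [].
  by apply: (compset_eq signed_sym); apply: compset_sub; rewrite -(comps_mem sub_sym Dh xD).
have [D1 [D2 [D1h D2h D12 fD]]] : exists D1 D2, [/\ D1 \in comps h :\ C, D2 \in comps h :\ C,
    D1 != D2 & f D1 = f D2].
  apply: contrapT => nex.
  have inj : {in comps h :\ C &, injective f}.
    by move=> D1 D2 D1h D2h fD; apply/eqP/negPn/negP => D12; apply: nex; exists D1, D2.
  have : (#|f @: (comps h :\ C)| <= ncomp s)%N.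
    apply: subset_leq_card; apply/subsetP => _ /imsetP [D /setD1P[_ Dh] ->].
    by have [x xD _] := comps_ex Dh; rewrite (fE D x) // mem_comps.
  rewrite card_in_imset //; move: cnt; rewrite /ncomp (cardsD1 C (comps h)) Ch add1n addn2 ltnS.
  by move=> H1 H2; have := leq_trans H1 H2; rewrite ltnn.
have lv D D' : D \in comps h :\ C -> D' \in comps h :\ C -> D != D' -> f D = f D' ->
    exists u v, [/\ u \in D, v \in C & s u v != 0].
  move=> /setD1P[DC Dh] /setD1P[_ Dh'] DD' fDD'.
  have [x xD _] := comps_ex Dh; have [y yD' _] := comps_ex Dh'.
  have xy : connect (adj s) x y.
    by have := compset_refl s y; rewrite -(fE _ _ Dh' yD') -fDD' (fE _ _ Dh xD) inE.
  have yD : y \notin D by apply: contra DD' => yD; apply/eqP; exact: (comps_eq sub_sym Dh Dh' yD yD').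
  have [u [v [uD vD suv huv]]] := compset_leave Dh xD yD xy.
  exists u, v; split=> //; have := cut_touch suv huv; case: (boolP (u \in C)) => //= uC _.
  by case/eqP: DC; exact: (comps_eq sub_sym Dh Ch uD uC).
have [u1 [v1 E1]] := lv D1 D2 D1h D2h D12 fD.
have D21 : D2 != D1 by rewrite eq_sym.
have [u2 [v2 E2]] := lv D2 D1 D2h D1h D21 (esym fD).
by exists D1, D2, u1, v1, u2, v2; move: D1h D2h => /setD1P[? ?] /setD1P[? ?].
Qed.

End OneCut.

(** Different new components are disjoint and every removed edge touches both. So it has one
    endpoint in each, and both functionals have value 1. *)
Lemma cut_eq C D g g' i j : cut C g -> cut D g' -> s i j != 0 -> g i + g j = g' i + g' j.
Proof.
move=> Cg Dg sij; apply: (mulfI sij).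
have [hij|hij] := eqVneq (h i j) 0; last by rewrite (cut_val0 Cg) // (cut_val0 Dg).
rewrite (cut_val Cg) // (cut_val Dg) //.
have [<-//|CD] := eqVneq C D.
have dis x : ~~ ((x \in C) && (x \in D)).
  apply/negP => /andP[xC xD]; case/eqP: CD; case: Cg Dg => Ch _ _ _ _ [Dh _ _ _ _].
  exact: (comps_eq sub_sym Ch Dh xC xD).
have := cut_touch Cg sij hij; have := cut_touch Dg sij hij; have := dis i; have := dis j.
by case: (i \in C); case: (j \in C); case: (i \in D); case: (j \in D).
Qed.

(** The three components lie in one component of [s], so the map from components of [h] to those of
    [s] stays surjective after [D] and [D'] are left out. *)
Lemma comps_merge C D D' : C \in comps h -> D \in comps h -> D' \in comps h ->
  C != D -> C != D' -> D != D' ->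
  (exists u v, [/\ u \in C, v \in D & s u v != 0]) ->
  (exists u v, [/\ u \in C, v \in D' & s u v != 0]) -> (ncomp s + 2 <= ncomp h)%N.
Proof.
move=> Ch Dh Dh' CD CD' DD' lD lD'.
have key E i : E \in comps h -> i \in E -> (exists u v, [/\ u \in C, v \in E & s u v != 0]) ->
    exists2 c, c \in C & compset s i = compset s c.
  move=> Eh iE [u [v [uC vE suv]]]; exists u => //.
  transitivity (compset s v).
    apply/esym/(compset_eq signed_sym)/compset_sub; rewrite -(comps_mem sub_sym Eh iE) //.
  by apply: (compset_eq signed_sym); rewrite inE connect1.
have [c cC _] := comps_ex Ch.
have all_c c' : c' \in C -> compset s c' = compset s c.
  move=> c'C; apply: (compset_eq signed_sym); apply: compset_sub.
  by rewrite -(comps_mem sub_sym Ch cC).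
pose f (E : {set 'I_n}) := if [pick x in E] is Some x then compset s x else set0.
have : (ncomp s <= #|f @: (comps h :\ D :\ D')|)%N.
  apply: subset_leq_card; apply/subsetP => _ /imsetP [i _ ->].
  have fC : compset s c = f C.
    by rewrite /f; case: pickP => [x xC|/(_ c)]; [rewrite (all_c x) | rewrite cC].
  have inC : C \in comps h :\ D :\ D' by rewrite !in_setD1 CD CD' Ch.
  have [iD|iD] := boolP (i \in D).
    by have [c' c'C ->] := key D i Dh iD lD; rewrite all_c // fC imset_f.
  have [iD'|iD'] := boolP (i \in D').
    by have [c' c'C ->] := key D' i Dh' iD' lD'; rewrite all_c // fC imset_f.
  have -> : compset s i = f (compset h i).
    rewrite /f; case: pickP => [x xi|/(_ i)]; last by rewrite compset_refl.
    by apply/esym/(compset_eq signed_sym)/compset_sub.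
  apply: imset_f; rewrite !in_setD1 mem_comps andbT; apply/andP; split.
    by apply: contra iD' => /eqP <-; exact: compset_refl.
  by apply: contra iD => /eqP <-; exact: compset_refl.
move/leq_trans => /(_ _ (leq_imset_card _ _)).
rewrite /ncomp (cardsD1 D (comps h)) (cardsD1 D' (comps h :\ D)) Dh in_setD1 eq_sym DD' Dh' /=.
by rewrite !add1n addn2 !ltnS.
Qed.

Hypothesis cuts : forall C, is_new C -> exists g, cut C g.

(* Every edge outside h touches every new component, so all of them lie in one component K of s. If K is bipartite
   it contains exactly two new components, otherwise only one. *)
Lemma nbicomp_cuts C : is_new C -> nbicomp h = (nbicomp s).+1.
Proof.
move=> newC; have [g Cg] := cuts newC; have /and3P[Ch bC nC] := newC.
have [c cC EC] := comps_ex Ch.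
have [p [q [spq hpq]]] : exists p q, s p q != 0 /\ h p q = 0.
  apply: contrapT => H; case/negP: nC; apply: comp_of_all => // i j _ sij.
  by apply/negP => /eqP hij; apply: H; exists i, j.
pose K := compset s c.
have CK x : x \in C -> x \in K by rewrite EC; exact: compset_sub.
have eK i j : s i j != 0 -> h i j = 0 -> i \in K /\ j \in K.
  move=> sij hij; have sji : s j i != 0 by rewrite signed_sym.
  case/orP: (cut_touch Cg sij hij) => /CK xK; split=> //.
    exact: compset_step sij xK.
  exact: compset_step sji xK.
pose BH := [set C in comps h | bipartite_comp h C].
pose BS := [set C in comps s | bipartite_comp s C].
pose old := [set C | comp_of s h C].
(* All removed edges lie in [K], so the components of [s] other than [K] survive in [h]; [K] itself
   does not, as it contains the new component [C]. *)
have E1 : BH :&: old = BS :\ K.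
  apply/setP => D; rewrite !inE; apply/idP/idP.
    case/andP => /andP[Dh bD] Dold; have Ds : D \in comps s by case/andP: Dold.
    rewrite Ds (bipartite_comp_of Dold bD) !andbT.
    apply: contra nC => /eqP DK; suff -> : C = D by [].
    by apply: (comps_eq sub_sym Ch Dh cC); rewrite DK; exact: compset_refl.
  case/and3P => DK Ds /existsP [L /existsP [R LR]].
  have [r rD ED] := comps_ex Ds.
  have nE i j : i \in D -> s i j != 0 -> h i j != 0.
    move=> iD sij; apply/negP => /eqP hij; case/eqP: DK.
    by apply: (comps_eq signed_sym Ds (mem_comps s c) iD); case: (eK i j sij hij).
  have Dh : D = compset h r.
    apply/setP => j; apply/idP/idP => [|]; last by rewrite ED; exact: compset_sub.
    rewrite ED inE => rj.
    suff [] : j \in D /\ j \in compset h r by [].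
    apply: (connect_adj_ind (K := fun j => j \in D /\ j \in compset h r) _ rj).
      move=> u v suv [uD ur]; split; first by rewrite -(comps_closed signed_sym Ds suv).
      by rewrite -(comps_closed sub_sym (mem_comps h r) (nE u v uD suv)).
    by split=> //; exact: compset_refl.
  rewrite {1}Dh mem_comps /=; apply/andP; split; last by apply: comp_of_all => //; rewrite Dh mem_comps.
  apply/existsP; exists L; apply/existsP; exists R; move/and3P: LR => [HL HR /forallP HE].
  apply/and3P; split=> //; apply/forallP => i; apply/forallP => j; apply/implyP => /andP[hij iD].
  by have /forallP /(_ j) := HE i; rewrite (sub_neq0 hij) iD.
have newE D : (D \in BH :\: old) = is_new D by rewrite !inE andbC -andbA.
have cut_new D x : is_new D -> x \in D -> D = compset h x.
  by case/and3P=> Dh _ _; exact: (comps_mem sub_sym Dh).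
have E2 : #|BH :\: old| = (K \in BS).+1.
  have [pK qK] := eK p q spq hpq.
  case: (boolP (K \in BS)); rewrite inE mem_comps /=.
    case/existsP => L /existsP [R LR].
    have [bv vK _ _] := bipartition_sgv signed_sym (mem_comps s c) LR.
    set v := sgv L R in bv vK.
    have vp : v p != 0 by rewrite vK.
    have vq : v q != 0 by rewrite vK.
    have vpq := bv _ _ spq.
    (* On a common component of [h] the product of [g] and [v] would be constant. As [v] changes
       sign from [p] to [q], so would [g], against its positivity on the removed edge. *)
    have npq : compset h p != compset h q.
      apply/negP => /eqP E; case: (Cg) => _ bg _ _ /(_ p q spq hpq) gpos.
      have := balanced_mul_const bg (balanced_sub bv) (_ : q \in compset h p).
      rewrite E compset_refl => /(_ isT).
      have -> : v q = - v p by apply/eqP; rewrite -addr_eq0 addrC vpq.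
      rewrite mulrN => gE.
      have : (g p + g q) * v p = 0 by rewrite mulrDl -gE addNr.
      move=> /eqP; rewrite mulf_eq0 (negPf vp) orbF => /eqP gpq.
      by move: gpos; rewrite gpq mulr0.
    have new x y : s x y != 0 -> compset h x != compset h y -> v x != 0 -> is_new (compset h x).
      move=> sxy nxy vx; rewrite /is_new mem_comps (balanced_bipartite sub_sym (balanced_sub bv) vx) /=.
      apply/negP => /comp_of_step /(_ (compset_refl h x) sxy) [yx _].
      by case/eqP: nxy; rewrite (compset_eq sub_sym yx).
    have -> : BH :\: old = [set compset h p; compset h q].
      apply/setP => D; rewrite newE !inE; apply/idP/orP.
        move=> newD; have [g' Dg'] := cuts newD.
        by case/orP: (cut_touch Dg' spq hpq) => /(cut_new _ _ newD) ->; rewrite eqxx; [left|right].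
      case=> /eqP ->; first exact: new spq npq vp.
      by apply: new vq; [rewrite signed_sym; exact: spq | rewrite eq_sym].
    by rewrite cards2 npq.
  move=> nbK; suff -> : BH :\: old = [set C] by rewrite cards1.
  apply/setP => D; rewrite newE inE; apply/idP/eqP => [newD|->//].
  apply/eqP/negPn/negP => DC; have [g' Dg] := cuts newD.
  (* By [cut_eq] the difference [g - g'] vanishes on every edge of [s]; it is nonzero at [c], where
     [g'] is zero, and would make [K] bipartite. *)
  case/negP: nbK; apply: (@balanced_bipartite _ s signed_sym (fun i => g i - g' i)).
    by move=> i j sij; rewrite addrACA -opprD (cut_eq Cg Dg sij) subrr.
  case: Cg Dg => _ _ gC _ _ [Dh _ gD _ _].
  have cD : c \notin D by apply: contra DC => cD; rewrite (comps_eq sub_sym Dh Ch cD cC).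
  have /eqP -> : g' c == 0 by apply/negPn; rewrite gD.
  by rewrite subr0 gC.
have -> : nbicomp h = (#|BH :&: old| + #|BH :\: old|)%N by rewrite cardsID.
by rewrite E1 E2 addnS /nbicomp -/BS (cardsD1 K BS) addnC.
Qed.

Section Lattice.
Variables (C : {set 'I_n}) (g : 'I_n -> int).
Hypothesis Cg : cut C g.

(** Bipartite components of [h] inherited from [s] give functionals balanced on [s]. For a new one
    the functional is, up to sign, [g] plus a balanced one by [cut_eq]. So [g] alone represents all
    new components in [edge_lattice]. *)
Lemma cut_lattice (K : 'rV[int]_n -> Prop) a :
  K 0 -> (forall b c, K b -> K c -> K (b + c)) -> (forall b, K b -> K (- b)) ->
  (forall i j, h i j != 0 -> K (rho s i j)) ->
  (forall v, balanced s v -> dot v a = 0) -> dot g a = 0 ->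
  (forall D, D \in comps h -> ~~ bipartite_comp h D -> (2 %| dot (fun i => (i \in D)%:R) a)%Z) ->
  K a.
Proof.
move=> K0 KD KN Kh Hs Hg Hn; apply: (edge_lattice sub_sym K0 KD KN) => [i j hij|D L R Dh LR|D Dh nD].
- have := Kh i j hij; rewrite rhoE; have [->|->] := signed_val (sub_neq0 hij); rewrite ?mulr1z //.
  by rewrite mulrNz mulr1z => /KN; rewrite opprK.
- have [bv vD v1 _] := bipartition_sgv sub_sym Dh LR; set v := sgv L R in bv vD v1 *.
  have [Dold|Dnew] := boolP (comp_of s h D).
    apply: Hs => i j sij; have [iD|iD] := boolP (i \in D).
      by have [_ hij] := comp_of_step Dold iD sij; apply: bv; rewrite hij.
    have jD : j \notin D.
      by apply: contra iD => jD; rewrite signed_sym in sij; case: (comp_of_step Dold jD sij).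
    by move: iD jD; rewrite -!vD !negbK => /eqP-> /eqP->.
  have newD : is_new D.
    rewrite /is_new Dh Dnew andbT; apply/existsP; exists L.
    by apply/existsP; exists R.
  have [g' Dg'] := cuts newD; have [_ bg' gD' g1' _] := Dg'.
  have Hg' : dot g' a = 0.
    have := dot_comb g' g 1 1 a; rewrite Hs ?Hg; first by rewrite mulr0 mul1r subr0 => <-.
    by move=> i j sij; rewrite !mul1r addrACA -opprD (cut_eq Dg' Cg sij) subrr.
  have [r rD ED] := comps_ex Dh.
  (* Balanced functionals are proportional on a component; for values 1 and -1 the factor is
     [v r * g' r]. *)
  have -> : dot v a = v r * g' r * dot g' a; last by rewrite Hg' mulr0.
  rewrite mulr_sumr; apply: eq_bigr => i _; rewrite mulrA; congr (_ * _).
  have [iD|iD] := boolP (i \in D).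
    rewrite -(balanced_mul_const bv bg' (_ : i \in compset h r)) -?ED // -mulrA.
    have {}iD : g' i != 0 by rewrite gD'.
    have [->|->] : g' i = 1 \/ g' i = -1 by move: (g1' i) iD; clear; lia.
      by rewrite !mulr1.
    by rewrite mulrNN !mulr1.
  by move: (vD i) (gD' i); rewrite (negPf iD) => /negbFE/eqP -> /negbFE/eqP ->; rewrite mulr0.
have -> : \sum_(i in D) a ord0 i = dot (fun i => (i \in D)%:R) a; last exact: Hn.
rewrite /dot big_mkcond; apply: eq_bigr => i _.
by case: (i \in D); rewrite ?mul1r ?mul0r.
Qed.

(** If some edge leaves [C], such an edge has the least value 1 and is chosen. By [comps_merge] all
    edges leaving [C] reach the same component, hence agree in every parity, and [t = 1]; edges
    inside [C] have value 2, and [t = 2]. If none leaves [C], all removed edges lie inside [C] and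
    any one serves. Vertices of [C] never contribute to a parity, since [C] is bipartite. *)
Lemma cut_generator (p0 q0 : 'I_n) : s p0 q0 != 0 -> h p0 q0 = 0 -> (ncomp h <= (ncomp s).+1)%N ->
  exists p q, [/\ s p q != 0, h p q = 0 & forall i j, s i j != 0 -> h i j = 0 ->
    exists2 t : nat, (0 < t)%N & dot g (rho s i j - rho s p q *+ t) = 0 /\
      forall D, D \in comps h -> ~~ bipartite_comp h D ->
        (2 %| dot (fun i => (i \in D)%:R) (rho s i j - rho s p q *+ t))%Z].
Proof.
move=> s0 h0 cnt; have [Ch _ _ _ _] := Cg.
have gE i j p q t : dot g (rho s i j - rho s p q *+ t) = s i j * (g i + g j) - s p q * (g p + g q) * t%:Z.
  by rewrite dotD dotN dotMn !dot_rho.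
have dE D i j p q t : dot (fun i => (i \in D)%:R) (rho s i j - rho s p q *+ t) =
    s i j * ((i \in D)%:R + (j \in D)%:R) - s p q * ((p \in D)%:R + (q \in D)%:R) * t%:Z.
  by rewrite dotD dotN dotMn !dot_rho.
have outC D i : D \in comps h -> ~~ bipartite_comp h D -> i \in C -> i \in D = false.
  move=> Dh nD iC; apply/negP => iD; case/negP: nD.
  rewrite (comps_eq sub_sym Dh Ch iD iC); case: Cg => _ bg gC _ _.
  by rewrite (comps_mem sub_sym Ch iC); apply: (balanced_bipartite sub_sym bg); rewrite gC.
have [[p [q [pC qC spq]]]|none] := pselect (exists p q, [/\ p \in C, q \notin C & s p q != 0]).
  have hpq : h p q = 0.
    by apply/eqP/negPn/negP => hpq; move: qC; rewrite -(comps_closed sub_sym Ch hpq) pC.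
  exists p, q; split=> //.
  have main i j : i \in C -> s i j != 0 -> h i j = 0 ->
      exists2 t : nat, (0 < t)%N & dot g (rho s i j - rho s p q *+ t) = 0 /\
      forall D, D \in comps h -> ~~ bipartite_comp h D ->
        (2 %| dot (fun i => (i \in D)%:R) (rho s i j - rho s p q *+ t))%Z.
    move=> iC sij hij; have [jC|jC] := boolP (j \in C).
      exists 2%N => //; split.
        by rewrite gE !(cut_val Cg) // iC jC pC (negPf qC).
      by move=> D Dh nD; rewrite dE (outC D i) // (outC D j) // (outC D p) // addr0 mulr0 sub0r -mulNr dvdz_mull.
    exists 1%N => //; split.
      by rewrite gE !(cut_val Cg) // iC (negPf jC) pC (negPf qC).
    move=> D Dh nD; rewrite dE (outC D i) // (outC D p) //.
    suff -> : (j \in D) = (q \in D).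
      by have [->|->] := signed_val sij; have [->|->] := signed_val spq; case: (q \in D).
    have [E|ne] := eqVneq (compset h j) (compset h q).
      have [-> //] : j \in D = (q \in D).
      apply/idP/idP => [jD|qD].
        by rewrite (comps_mem sub_sym Dh jD) E compset_refl.
      by rewrite (comps_mem sub_sym Dh qD) -E compset_refl.
    have nC x : x \notin C -> C != compset h x.
      by apply: contra => /eqP ->; exact: compset_refl.
    have := comps_merge Ch (mem_comps h j) (mem_comps h q) (nC _ jC) (nC _ qC) ne.
    have H1 : exists u v, [/\ u \in C, v \in compset h j & s u v != 0].
      by exists i, j; rewrite compset_refl.
    have H2 : exists u v, [/\ u \in C, v \in compset h q & s u v != 0].
      by exists p, q; rewrite compset_refl.
    by move=> /(_ H1 H2); rewrite addn2 => H; have := leq_trans H cnt; rewrite ltnn.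
  move=> i j sij hij; case/orP: (cut_touch Cg sij hij) => xC; first exact: main.
  have -> : rho s i j = rho s j i by rewrite !rhoE signed_sym [_ + delta_mx _ j]addrC.
  have sji : s j i != 0 by rewrite signed_sym.
  have hji : h j i = 0 by rewrite sub_sym.
  exact: main.
have inC i j : s i j != 0 -> h i j = 0 -> i \in C /\ j \in C.
  move=> sij hij; have := cut_touch Cg sij hij.
  case: (boolP (i \in C)); case: (boolP (j \in C)) => // x y _; case: none.
    by exists i, j.
  by exists j, i; split=> //; rewrite signed_sym.
exists p0, q0; split=> // i j sij hij; exists 1%N => //.
have [iC jC] := inC i j sij hij; have [pC qC] := inC p0 q0 s0 h0.
split; first by rewrite gE !(cut_val Cg) // iC jC pC qC.
by move=> D Dh nD; rewrite dE (outC D i) // (outC D j) // (outC D p0) // (outC D q0) // !addr0 !mulr0 mul0r subr0 dvdz0.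
Qed.

End Lattice.
End Cuts.

(** * Height-one primes of semigroup rings *)

Section MonomialBasis.
Variables (k : fieldType) (n : nat) (S : 'rV[int]_n -> Prop).
Variables (A : comAlgType k) (e : 'rV[int]_n -> A).
Hypotheses (S0 : S 0) (SD : forall a b, S a -> S b -> S (a + b)).
Hypothesis e0 : e 0 = 1.
Hypothesis eD : forall a b, S a -> S b -> e (a + b) = e a * e b.
Hypothesis e_free : forall l : seq ('rV[int]_n * k),
  uniq (map fst l) -> (forall p, p \in l -> S p.1) ->
  \sum_(p <- l) p.2 *: e p.1 = 0 -> forall p, p \in l -> p.2 = 0.
Hypothesis e_span : forall x : A, exists l : seq ('rV[int]_n * k),
  (forall p, p \in l -> S p.1) /\ x = \sum_(p <- l) p.2 *: e p.1.

(** * Coefficients in the monomial basis *)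

Definition list_coef (l : seq ('rV[int]_n * k)) a := \sum_(p <- l | p.1 == a) p.2.

Lemma list_coefE l : \sum_(p <- l) p.2 *: e p.1 =
  \sum_(a <- undup (map fst l)) list_coef l a *: e a.
Proof.
under [RHS]eq_bigr do rewrite scaler_suml big_mkcond.
rewrite exchange_big /= big_seq_cond [RHS]big_seq_cond.
apply: eq_bigr => p; rewrite andbT => lp.
have /= Hp : p.1 \in undup (map fst l) by rewrite mem_undup map_f.
rewrite (bigD1_seq p.1) ?undup_uniq //= eqxx big1 ?addr0 // => a.
by rewrite eq_sym => /negPf->.
Qed.

Lemma list_coef_eq0 l : (forall p, p \in l -> S p.1) ->
  \sum_(p <- l) p.2 *: e p.1 = 0 -> forall a, list_coef l a = 0.
Proof.
move=> Sl; rewrite list_coefE => H a.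
have [al|nal] := boolP (a \in undup (map fst l)); last first.
  rewrite /list_coef big_seq_cond big1 // => p /andP[lp /eqP E].
  by case/negP: nal; rewrite mem_undup -E map_f.
pose l' := [seq (b, list_coef l b) | b <- undup (map fst l)].
apply: (@e_free l' _ _ _ (a, list_coef l a)).
- by rewrite -map_comp map_id undup_uniq.
- move=> p /mapP[b]; rewrite mem_undup => /mapP[q lq ->] -> /=; exact: Sl.
- by rewrite big_map.
- by apply/mapP; exists a.
Qed.

(** Spanning is a mere existence statement, so a list is chosen; by [coef_list] the coefficients do
    not depend on it. *)
Definition mrepr x := sval (cid (e_span x)).
Definition coef x a := list_coef (mrepr x) a.

Lemma coef_list x l a : (forall p, p \in l -> S p.1) ->
  x = \sum_(p <- l) p.2 *: e p.1 -> coef x a = list_coef l a.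
Proof.
move=> Sl El; rewrite /coef /mrepr; case: (cid _) => r /= [Sr Er].
pose m := [seq (p.1, - p.2) | p <- l].
have /(_ a) : forall a, list_coef (r ++ m) a = 0.
  apply: list_coef_eq0.
    move=> p; rewrite mem_cat => /orP[/Sr //|/mapP[q /Sl ? ->] //].
  rewrite big_cat big_map /= -Er -[RHS](subrr x); congr (_ + _).
  by rewrite El -sumrN; apply: eq_bigr => p _; rewrite scaleNr.
rewrite /list_coef big_cat big_map /= sumrN => /eqP.
by rewrite subr_eq0 => /eqP.
Qed.

Lemma coef_notin x a : ~ S a -> coef x a = 0.
Proof.
rewrite /coef /mrepr; case: (cid _) => r /= [Sr Er] nS.
rewrite /list_coef big_seq_cond big1 // => p /andP[/Sr Sp /eqP E].
by rewrite E in Sp.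
Qed.

Lemma coef_neq0 x a : coef x a != 0 -> S a.
Proof. by move=> H; apply: contrapT => /(coef_notin x) E; rewrite E eqxx in H. Qed.

Lemma coefD x y a : coef (x + y) a = coef x a + coef y a.
Proof.
rewrite {2 3}/coef /mrepr; case: (cid _) => r /= [Sr Er].
case: (cid _) => t /= [St Et].
rewrite (@coef_list _ (r ++ t)) ?Et; first by rewrite /list_coef big_cat.
- by move=> p; rewrite mem_cat => /orP[/Sr|/St].
- by rewrite Er big_cat.
Qed.

Lemma coefZ c x a : coef (c *: x) a = c * coef x a.
Proof.
rewrite {2}/coef /mrepr; case: (cid _) => r /= [Sr Er].
rewrite (@coef_list _ [seq (p.1, c * p.2) | p <- r]).
- by rewrite /list_coef big_map mulr_sumr.
- by move=> p /mapP[q /Sr ? ->].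
- by rewrite big_map {1}Er scaler_sumr; apply: eq_bigr => p _; rewrite scalerA.
Qed.

Lemma coef0 a : coef 0 a = 0.
Proof. by rewrite -(scale0r 0) coefZ mul0r. Qed.

Lemma coefN x a : coef (- x) a = - coef x a.
Proof. by rewrite -scaleN1r coefZ mulN1r. Qed.

Lemma coefB x y a : coef (x - y) a = coef x a - coef y a.
Proof. by rewrite coefD coefN. Qed.

Lemma coef_sum (I : Type) (r : seq I) (Q : pred I) F a :
  coef (\sum_(i <- r | Q i) F i) a = \sum_(i <- r | Q i) coef (F i) a.
Proof. by elim/big_rec2: _ => [|i x y _ <-]; rewrite ?coef0 ?coefD. Qed.

Lemma coef_e a b : S a -> coef (e a) b = (b == a)%:R.
Proof.
move=> Sa; rewrite (@coef_list _ [:: (a, 1)]).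
- by rewrite /list_coef big_cons big_nil /= eq_sym; case: eqP => //; rewrite addr0.
- by move=> p; rewrite inE => /eqP->.
- by rewrite big_cons big_nil addr0 scale1r.
Qed.

Definition msupp x := [seq a <- undup (map fst (mrepr x)) | coef x a != 0].

Lemma mem_msupp x a : (a \in msupp x) = (coef x a != 0).
Proof.
rewrite mem_filter mem_undup; case: (boolP (coef x a != 0)) => //= H.
apply/negP => nI; apply: (negP H); rewrite /coef /list_coef big_seq_cond big1 //.
by move=> p /andP[lp /eqP E]; case: nI; rewrite -E map_f.
Qed.

Lemma msupp_uniq x : uniq (msupp x).
Proof. by rewrite filter_uniq ?undup_uniq. Qed.

Lemma msuppS x a : a \in msupp x -> S a.
Proof. by rewrite mem_msupp => /coef_neq0. Qed.

Lemma msuppE x : x = \sum_(a <- msupp x) coef x a *: e a.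
Proof.
rewrite big_filter big_mkcond /=.
transitivity (\sum_(a <- undup (map fst (mrepr x))) coef x a *: e a); last first.
  by apply: eq_bigr => a _; case: eqP => //= ->; rewrite scale0r.
by rewrite -list_coefE /mrepr; case: (cid _) => r /= [_].
Qed.

Lemma coef_inj x y : (forall a, coef x a = coef y a) -> x = y.
Proof.
move=> H; apply/eqP; rewrite -subr_eq0 (msuppE (x - y)) big_seq big1 // => a.
by rewrite mem_msupp coefB H subrr eqxx.
Qed.

Lemma coef_eq0 x : (forall a, coef x a = 0) -> x = 0.
Proof. by move=> H; apply: coef_inj => a; rewrite H coef0. Qed.

Lemma neq0_coef x : x <> 0 -> exists a, coef x a != 0.
Proof.
move=> nx; apply: contrapT => H; apply: nx; apply: coef_eq0 => a.
by apply/eqP/negPn/negP => H'; apply: H; exists a.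
Qed.

Lemma coef_eM b x a : S b -> coef (e b * x) a = coef x (a - b).
Proof.
move=> Sb; rewrite {1}(msuppE x) mulr_sumr coef_sum.
have E c : c \in msupp x -> coef (e b * (coef x c *: e c)) a = coef x c * (a - b == c)%:R.
  move=> cx; have Sc := msuppS cx; rewrite -scalerAr coefZ -(eD Sb Sc) (coef_e _ (SD Sb Sc)).
  by rewrite -subr_eq0 opprD addrA subr_eq0.
rewrite (eq_big_seq _ E) {E}.
have [ax|nax] := boolP (a - b \in msupp x); last first.
  rewrite big1_seq => [|c /andP[_ cx]].
    by move: nax; rewrite mem_msupp negbK => /eqP.
  by case: eqP => [E|]; rewrite ?mulr0 // -E (negPf nax) in cx *.
rewrite (bigD1_seq (a - b)) ?msupp_uniq //= eqxx mulr1 big1 ?addr0 // => c.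
by rewrite eq_sym => /negPf->; rewrite mulr0.
Qed.

Lemma coefM x y c : coef (x * y) c = \sum_(a <- msupp x) coef x a * coef y (c - a).
Proof.
rewrite {1}(msuppE x) mulr_suml coef_sum; apply: eq_big_seq => a ax.
by rewrite -scalerAl coefZ (coef_eM _ _ (msuppS ax)).
Qed.

(** * Projections to sets of monomials, and supports *)

Definition proj (T : pred 'rV[int]_n) x := \sum_(a <- msupp x | T a) coef x a *: e a.

Lemma coef_proj T x a : coef (proj T x) a = if T a then coef x a else 0.
Proof.
rewrite coef_sum; have [ax|nax] := boolP (a \in msupp x); last first.
  rewrite big1_seq => [|c /andP[_ cx]]; last first.
    rewrite coefZ (coef_e _ (msuppS cx)).
    by case: eqP => [E|]; rewrite ?mulr0 // E cx in nax *.
  by move: nax; rewrite mem_msupp negbK => /eqP ->; case: ifP.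
rewrite big_mkcond (bigD1_seq a) ?msupp_uniq //= coefZ (coef_e _ (msuppS ax)) eqxx mulr1.
rewrite big1_seq ?addr0 // => c /andP[ca cx]; case: ifP => // _.
by rewrite coefZ (coef_e _ (msuppS cx)) eq_sym (negPf ca) mulr0.
Qed.

Definition supp (T : 'rV[int]_n -> Prop) x := forall a, coef x a != 0 -> T a.

Lemma supp_coef0 T x a : supp T x -> ~ T a -> coef x a = 0.
Proof. by move=> sx nT; apply/eqP/negPn/negP => /sx. Qed.

Lemma suppD T x y : supp T x -> supp T y -> supp T (x + y).
Proof.
move=> sx sy a; apply: contraNP => nT; rewrite coefD.
by rewrite (supp_coef0 sx nT) (supp_coef0 sy nT) addr0.
Qed.

Lemma suppZ T c x : supp T x -> supp T (c *: x).
Proof.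
by move=> sx a; apply: contraNP => nT; rewrite coefZ (supp_coef0 sx nT) mulr0.
Qed.

Lemma suppN T x : supp T x -> supp T (- x).
Proof. by move=> sx; rewrite -scaleN1r; exact: suppZ. Qed.

Lemma suppB T x y : supp T x -> supp T y -> supp T (x - y).
Proof. by move=> sx sy; exact: suppD (suppN _). Qed.

Lemma supp0 T : supp T 0.
Proof. by move=> a; rewrite coef0 eqxx. Qed.

Lemma supp_e (T : 'rV[int]_n -> Prop) a : S a -> T a -> supp T (e a).
Proof. by move=> Sa Ta b; rewrite (coef_e b Sa); case: (b =P a) => [->|_]; rewrite ?eqxx. Qed.

Lemma supp_sub (T T' : 'rV[int]_n -> Prop) x :
  supp T x -> (forall a, S a -> T a -> T' a) -> supp T' x.
Proof. by move=> sx TT' a xa; apply: TT' => //; [exact: coef_neq0 xa | exact: sx]. Qed.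

Lemma supp_mul (T1 T2 T3 : 'rV[int]_n -> Prop) x y :
  supp T1 x -> supp T2 y ->
  (forall a b, S a -> S b -> T1 a -> T2 b -> T3 (a + b)) -> supp T3 (x * y).
Proof.
move=> sx sy T123 c; apply: contraNP => nT; rewrite coefM big1_seq // => a /andP[_].
rewrite mem_msupp => xa; have [->|yb] := eqVneq (coef y (c - a)) 0; first by rewrite mulr0.
case: nT; rewrite -(subrKC a c); apply: T123.
- exact: coef_neq0 xa.
- exact: coef_neq0 yb.
- exact: sx.
- exact: sy.
Qed.

Lemma supp_disj (T : 'rV[int]_n -> Prop) x : supp T x -> supp (fun a => ~ T a) x -> x = 0.
Proof.
move=> s1 s2; apply: coef_eq0 => a; apply/eqP/negPn/negP => xa.
exact: (s2 _ xa) (s1 _ xa).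
Qed.

Lemma supp_proj (T : pred 'rV[int]_n) x : supp T (proj T x).
Proof. by move=> a; rewrite coef_proj; case: ifP => //; rewrite eqxx. Qed.

Arguments supp_proj : clear implicits.

Lemma supp_proj2 (T : pred 'rV[int]_n) (U : 'rV[int]_n -> Prop) x :
  supp U x -> supp U (proj T x).
Proof. by move=> sx a; rewrite coef_proj; case: ifP => [_ /sx //|]; rewrite eqxx. Qed.

Lemma projC (T : pred 'rV[int]_n) x : x = proj T x + proj (predC T) x.
Proof.
by apply: coef_inj => a; rewrite coefD !coef_proj /=; case: (T a); rewrite ?addr0 ?add0r.
Qed.

Lemma proj_supp (T : pred 'rV[int]_n) x : supp T x -> proj T x = x.
Proof.
move=> sx; apply: coef_inj => a; rewrite coef_proj; case: ifP => // /negP nT.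
by rewrite (supp_coef0 sx).
Qed.

Lemma proj_suppC (T : pred 'rV[int]_n) x : supp (fun a => ~ T a) x -> proj T x = 0.
Proof.
move=> sx; apply: coef_eq0 => a; rewrite coef_proj; case: ifP => // Ta.
by rewrite (supp_coef0 sx) // => /(_ Ta).
Qed.

Lemma projD T x y : proj T (x + y) = proj T x + proj T y.
Proof. by apply: coef_inj => a; rewrite coefD !coef_proj coefD; case: ifP; rewrite ?addr0. Qed.

Lemma projZ T c x : proj T (c *: x) = c *: proj T x.
Proof. by apply: coef_inj => a; rewrite coefZ !coef_proj coefZ; case: ifP; rewrite ?mulr0. Qed.

Lemma proj0 T : proj T 0 = 0.
Proof. by apply: coef_inj => a; rewrite coef_proj coef0 if_same. Qed.

Lemma e_neq0 a : S a -> e a <> 0.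
Proof.
by move=> Sa E; have := coef_e a Sa; rewrite E coef0 eqxx => /esym/eqP; rewrite oner_eq0.
Qed.

(** * Gradings, and the absence of zero divisors *)

Definition additive_deg (f : 'rV[int]_n -> int) := forall a b, f (a + b) = f a + f b.

Definition hcomp (f : 'rV[int]_n -> int) c x := proj (fun a => f a == c) x.

Lemma hcomp_sum f x : x = \sum_(c <- undup (map f (msupp x))) hcomp f c x.
Proof.
apply: coef_inj => a; rewrite coef_sum.
have [ax|nax] := boolP (a \in msupp x); last first.
  have E : coef x a = 0 by move: nax; rewrite mem_msupp negbK => /eqP.
  by rewrite E big1 // => c _; rewrite coef_proj E if_same.
rewrite (bigD1_seq (f a)) ?undup_uniq ?mem_undup ?map_f //= coef_proj eqxx.
by rewrite big1 ?addr0 // => c; rewrite coef_proj eq_sym => /negPf->.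
Qed.

(** The bounds need not be attained. For [- f] and bound 0 this says that passing to the part on a
    face is multiplicative. *)
Lemma hcompM_top f c d x y : additive_deg f ->
  supp (fun a => f a <= c) x -> supp (fun a => f a <= d) y ->
  hcomp f (c + d) (x * y) = hcomp f c x * hcomp f d y.
Proof.
move=> fD sx sy.
set T := fun c a => f a == c.
have lt c' z : supp (fun a => f a <= c') z -> supp (fun a => f a < c') (proj (predC (T c')) z).
  by move=> sz a; rewrite coef_proj /= /T; case: (f a =P c') => [_|ne] /=; rewrite ?eqxx // => za; have := sz _ za; lia.
have eqd c' z : supp (fun a => f a = c') (proj (T c') z).
  by apply: (supp_sub (supp_proj (T c') z)) => a _ /eqP.
rewrite {1}(projC (T c) x) {1}(projC (T d) y) mulrDl !mulrDr /hcomp !projD.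
rewrite [X in X + _ + _]proj_supp; last first.
  apply: (supp_mul (eqd c x) (eqd d y)) => a b _ _ /= fa fb.
  by rewrite fD fa fb.
have Z z : supp (fun a => f a < c + d) z -> proj (T (c + d)) z = 0.
  by move=> sz; apply: proj_suppC => a /sz /=; rewrite /T; lia.
rewrite !Z ?addr0 //; [| |];
  first [apply: (supp_mul (lt _ _ sx) (lt _ _ sy)) | apply: (supp_mul (lt _ _ sx) (eqd d y))
    |apply: (supp_mul (eqd c x) (lt _ _ sy))];
  by move=> a b _ _ /= fa fb; rewrite fD; lia.
Qed.

Lemma seq_max (T : eqType) (f : T -> int) (Q : pred T) (l : seq T) : has Q l ->
  exists a, [/\ a \in l, Q a & forall b, b \in l -> Q b -> f b <= f a].
Proof.
elim: l => //= a l IH; have [/IH [b [bl Qb bM]] _|nQ] := boolP (has Q l); last first.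
  rewrite orbF => Qa; exists a; rewrite mem_head; split=> // b; rewrite inE => /predU1P[->//|bl Qb].
  by case/negP: nQ; apply/hasP; exists b.
have [Qa|nQa] := boolP (Q a && (f b <= f a)); last first.
  exists b; rewrite inE bl orbT; split=> // c; rewrite inE => /predU1P[-> Qc|]; last exact: bM.
  by move: nQa; rewrite Qc /=; lia.
case/andP: Qa => Qa ba; exists a; rewrite mem_head; split=> // c.
by rewrite inE => /predU1P[->//|cl Qc]; apply: le_trans ba; exact: bM.
Qed.

Lemma hcomp_top f x : x <> 0 ->
  exists c, hcomp f c x <> 0 /\ supp (fun a => f a <= c) x.
Proof.
move=> /neq0_coef [a0 xa0].
have /(seq_max f) [a [ax _ aM]] : has predT (msupp x) by apply/hasP; exists a0; rewrite ?mem_msupp.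
exists (f a); split=> [E|b]; last by rewrite -mem_msupp => /aM ->.
by have := coef_proj (fun b => f b == f a) x a; rewrite -/(hcomp _ _ _) E coef0 eqxx => /esym/eqP;
  apply/negP; rewrite -mem_msupp.
Qed.

(** Homogeneity in the coordinates from [i] on: no condition for [i = n], a scalar multiple of one
    monomial for [i = 0]. Lowering [i] one step at a time plays the role of a monomial order. *)
Definition hom_at i (v : 'rV[int]_n) x :=
  supp (fun a => forall j : 'I_n, (i <= j)%N -> a 0 j = v 0 j) x.
Definition hom i x := exists v, hom_at i v x.

Lemma hom_at_mul i u v x y : hom_at i u x -> hom_at i v y -> hom_at i (u + v) (x * y).
Proof. by move=> hx hy; apply: (supp_mul hx hy) => a b _ _ /= ha hb j ij; rewrite !mxE ha ?hb. Qed.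

Lemma hom_mul i x y : hom i x -> hom i y -> hom i (x * y).
Proof. by move=> [u hx] [v hy]; exists (u + v); exact: hom_at_mul. Qed.

Lemma hom_full x : hom n x.
Proof. by exists 0 => a _ j; rewrite leqNgt ltn_ord. Qed.

Lemma hom_e i a : S a -> hom i (e a).
Proof. by move=> Sa; exists a; apply: supp_e. Qed.

Lemma hom0E x : hom 0 x -> x <> 0 -> exists a, [/\ S a, coef x a != 0 & x = coef x a *: e a].
Proof.
move=> [v hx] /neq0_coef [a xa]; exists a; split=> //; first exact: coef_neq0 xa.
have hv b : coef x b != 0 -> b = v.
  by move=> xb; apply/rowP => j; exact: hx.
apply: coef_inj => b; rewrite coefZ (coef_e _ (coef_neq0 xa)).
case: (b =P a) => [->|ba]; rewrite ?mulr1 // mulr0; apply/eqP/negPn/negP => xb.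
by case: ba; rewrite (hv _ xa) (hv _ xb).
Qed.

Lemma hom_hcomp (j : 'I_n) c x : hom j.+1 x -> hom j (hcomp (fun a => a 0 j) c x).
Proof.
move=> [v hx]; exists (\row_i (if i == j then c else v 0 i)) => a.
rewrite coef_proj; case: (a 0 j =P c) => [aj /hx Ha|]; rewrite ?eqxx // => i ij.
rewrite mxE; case: eqP => [->//|/eqP ne]; apply: Ha; rewrite ltn_neqAle ij andbT.
by rewrite eq_sym.
Qed.

Lemma coord_additive (j : 'I_n) : additive_deg (fun a => a 0 j).
Proof. by move=> a b; rewrite mxE. Qed.

(** The top components in coordinate [i] are homogeneous in one coordinate more, and their product
    is the top component of the product. At [i = 0] only monomials remain. *)
Lemma hom_mul_neq0 i x y : (i <= n)%N -> hom i x -> hom i y ->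
  x <> 0 -> y <> 0 -> x * y <> 0.
Proof.
elim: i x y => [|i IH] x y ilen hx hy nx ny.
  have [a [Sa xa ->]] := hom0E hx nx; have [b [Sb yb ->]] := hom0E hy ny.
  rewrite -scalerAl -scalerAr scalerA -eD // => /eqP.
  rewrite scaler_eq0 mulf_eq0 (negPf xa) (negPf yb) /= => /eqP.
  by apply: e_neq0; exact: SD.
pose j := Ordinal ilen.
have [c [xc sx]] := hcomp_top (fun a => a 0 j) nx.
have [d [yd sy]] := hcomp_top (fun a => a 0 j) ny.
have := IH _ _ (ltnW ilen) (@hom_hcomp j c x hx) (@hom_hcomp j d y hy) xc yd.
rewrite -hcompM_top // => [ne E|]; last exact: coord_additive.
by apply: ne; rewrite E /hcomp proj0.
Qed.

Lemma mul_neq0 (x y : A) : x <> 0 -> y <> 0 -> x * y <> 0.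
Proof. exact: (hom_mul_neq0 (leqnn n) (@hom_full x) (@hom_full y)). Qed.

(** * The homogeneous core of a prime *)

Section PrimeFacts.
Variable P : A -> Prop.
Hypothesis Pp : is_prime P.

Lemma prime0 : P 0. Proof. by case: Pp => [[]]. Qed.
Lemma primeD x y : P x -> P y -> P (x + y). Proof. by case: Pp => [[_ H _] _ _]; exact: H. Qed.
Lemma primeMl r x : P x -> P (r * x). Proof. by case: Pp => [[_ _ H] _ _]; exact: H. Qed.
Lemma primeMr r x : P x -> P (x * r). Proof. by rewrite mulrC; exact: primeMl. Qed.
Lemma primeZ c x : P x -> P (c *: x). Proof. by rewrite -mulr_algl; exact: primeMl. Qed.
Lemma primeB x y : P x -> P y -> P (x - y).
Proof. by move=> Px Py; apply: primeD => //; rewrite -scaleN1r; exact: primeZ. Qed.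
Lemma prime1 : ~ P 1. Proof. by case: Pp. Qed.
Lemma primeM x y : P (x * y) -> P x \/ P y. Proof. by case: Pp => _ _; exact. Qed.
Lemma prime_notM x y : ~ P x -> ~ P y -> ~ P (x * y).
Proof. by move=> nx ny /primeM []. Qed.
Lemma prime_sum (I : eqType) (r : seq I) F : (forall i, i \in r -> P (F i)) -> P (\sum_(i <- r) F i).
Proof.
by move=> H; rewrite big_seq; apply: big_ind; [exact: prime0 | exact: primeD | exact: H].
Qed.

(** The largest ideal inside [P] that is homogeneous for [f]. *)
Definition homcore (f : 'rV[int]_n -> int) x := forall c, P (hcomp f c x).

Variable f : 'rV[int]_n -> int.
Hypothesis fD : additive_deg f.

Lemma hcomp_eM a c x : S a -> hcomp f c (e a * x) = e a * hcomp f (c - f a) x.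
Proof.
move=> Sa; apply: coef_inj => b; rewrite coef_eM // !coef_proj coef_eM //.
have -> : (f b == c) = (f (b - a) == c - f a); last by [].
by rewrite -[RHS](inj_eq (addIr (f a))) subrK -fD subrK.
Qed.

Lemma homcoreM r x : homcore f x -> homcore f (r * x).
Proof.
move=> Hx c; rewrite (msuppE r) mulr_suml; elim: (msupp r) (@msuppS r) => [|a l IH] Sl.
  by rewrite big_nil /hcomp proj0; exact: prime0.
rewrite big_cons /hcomp projD; apply: primeD; last first.
  by apply: IH => b bl; apply: Sl; rewrite inE bl orbT.
rewrite -scalerAl projZ; apply: primeZ.
by rewrite -/(hcomp f c (e a * x)) (hcomp_eM _ _ (Sl a (mem_head a l))); apply: primeMl; exact: Hx.
Qed.

Lemma homcoreD x y : homcore f x -> homcore f y -> homcore f (x + y).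
Proof. by move=> Hx Hy c; rewrite /hcomp projD; apply: primeD; [exact: Hx | exact: Hy]. Qed.

Lemma homcore_sub x : homcore f x -> P x.
Proof. by move=> Hx; rewrite (hcomp_sum f x); apply: prime_sum => c _; exact: Hx. Qed.

Lemma homcore_top x : ~ homcore f x ->
  exists c, ~ P (hcomp f c x) /\ homcore f (proj (fun a => c < f a) x).
Proof.
move=> /existsNP [c0 nc0].
have [|c [_ /asboolP nPc cM]] := @seq_max _ id (fun c => `[< ~ P (hcomp f c x)>])
    (undup (map f (msupp x))).
  apply/hasP; exists c0; last exact/asboolP.
  rewrite mem_undup; apply/mapP; apply: contrapT => H; apply: nc0.
  rewrite (_ : hcomp _ _ _ = 0); first exact: prime0.
  apply: coef_eq0 => a; rewrite coef_proj; case: eqP => // E; apply/eqP/negPn/negP => xa.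
  by apply: H; exists a; rewrite ?mem_msupp.
exists c; split=> // d.
have -> : hcomp f d (proj (fun a => c < f a) x) = if c < d then hcomp f d x else 0.
  apply: coef_inj => a; rewrite (fun_if (coef^~ a)) !coef_proj coef0.
  by case: eqP => [->|]; rewrite ?if_same.
case: ifP => cd; last exact: prime0.
have [dl|ndl] := boolP (d \in undup (map f (msupp x))).
  apply: contrapT => nd; have := cM d dl (introT (asboolP _) nd); rewrite /=; lia.
rewrite (_ : hcomp _ _ _ = 0); first exact: prime0.
apply: coef_eq0 => a; rewrite coef_proj; case: eqP => // E; apply/eqP/negPn/negP => xa.
by case/negP: ndl; rewrite mem_undup -E map_f ?mem_msupp.
Qed.

Lemma homcore_prime : is_prime (homcore f).
Proof.
split.
- split; [move=> c; rewrite /hcomp proj0; exact: prime0 | exact: homcoreD|exact: homcoreM].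
- by move/homcore_sub; exact: prime1.
move=> x y Hxy; apply: contrapT => /not_orP [/homcore_top [c [nxc Hx]] /homcore_top [d [nyd Hy]]].
set x1 := proj _ x in Hx; set y1 := proj _ y in Hy.
have le b z : supp (fun a => f a <= b) (z - proj (fun a => b < f a) z).
  move=> a; rewrite coefB coef_proj; case: ifP; rewrite ?subrr ?eqxx //; lia.
have cle b z : hcomp f b (z - proj (fun a => b < f a) z) = hcomp f b z.
  apply: coef_inj => a; rewrite !coef_proj coefB coef_proj; case: eqP => // ->.
  by rewrite ltxx subr0.
have : homcore f ((x - x1) * (y - y1)).
  have -> : (x - x1) * (y - y1) = x * y + (- y * x1 + - (x - x1) * y1) by ring.
  by apply: homcoreD => //; apply: homcoreD; apply: homcoreM.
by move/(_ (c + d)); rewrite (hcompM_top fD (le c x) (le d y)) !cle => /primeM [].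
Qed.

End PrimeFacts.

(** * Minimal nonzero primes *)

Definition min_prime (P : A -> Prop) :=
  [/\ is_prime P, exists x, P x /\ x <> 0 &
   forall Q : A -> Prop, is_prime Q -> (forall x, Q x -> P x) -> (exists x, Q x /\ x <> 0) ->
     forall x, P x -> Q x].

Definition loc_principal (P : A -> Prop) :=
  exists f, P f /\ forall g, P g -> exists u, ~ P u /\ exists r, u * g = r * f.

Section MinimalPrime.
Variable P : A -> Prop.
Hypothesis Pm : min_prime P.
Let Pp : is_prime P. Proof. by case: Pm. Qed.

(** The core of [P] is a prime containing [y], so by minimality it is all of [P]. *)
Lemma min_prime_hcomp f c y : additive_deg f -> P y -> y <> 0 -> supp (fun a => f a = c) y ->
  forall x d, P x -> P (hcomp f d x).
Proof.
move=> fD Py ny sy x d Px; case: Pm => _ _ /(_ _ (homcore_prime Pp fD)); apply=> //.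
  exact: homcore_sub.
exists y; split=> // b; have [->|bc] := eqVneq b c.
  by rewrite /hcomp proj_supp //; apply: (supp_sub sy) => a _ ->.
rewrite /hcomp proj_suppC; first exact: prime0.
by apply: (supp_sub sy) => a _ ->; apply/negP; rewrite eq_sym.
Qed.

(** As [y] is homogeneous in each coordinate from [i] on, [P] contains the components of its
    elements in these coordinates, and every element is a sum of such components. *)
Lemma min_prime_hom_ind i y (K : A -> Prop) : (i <= n)%N -> P y -> y <> 0 -> hom i y ->
  K 0 -> (forall x z, K x -> K z -> K (x + z)) -> (forall x, P x -> hom i x -> K x) ->
  forall x, P x -> K x.
Proof.
move=> ilen Py ny [v hy] K0 KD KH.
suff H m : (i + m <= n)%N -> forall x, P x -> hom (i + m)%N x -> K x.
  by move=> x Px; apply: (H (n - i)%N); rewrite ?subnKC //; exact: hom_full.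
elim: m => [|m IH]; first by rewrite addn0 => _; exact: KH.
rewrite addnS => imn x Px hx; pose j := Ordinal imn.
rewrite (hcomp_sum (fun a => a 0 j) x); apply: (big_ind K) => // c _.
apply: IH; rewrite ?(ltnW imn) //; last exact: hom_hcomp.
apply: (min_prime_hcomp (c := v 0 j) _ Py ny) => //; first exact: coord_additive.
by apply: (supp_sub hy) => a _; apply; rewrite /= leq_addr.
Qed.

Lemma hom_width (j : 'I_n) x : exists (w : nat) lo, supp (fun a => lo <= a 0 j <= lo + w%:Z) x.
Proof.
have [->|/eqP nx] := eqVneq x 0; first by exists 0%N, 0; exact: supp0.
have [c [_ sc]] := hcomp_top (fun a => a 0 j) nx.
have [d [_ sd]] := hcomp_top (fun a => - a 0 j) nx.
exists (absz (c + d)), (- d) => a xa; have := sc _ xa; have := sd _ xa; lia.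
Qed.

Lemma width_top (j : 'I_n) lo (w : nat) x :
  supp (fun a => lo <= a 0 j <= lo + w%:Z) x -> hcomp (fun a => a 0 j) (lo + w%:Z) x = 0 ->
  x <> 0 -> (0 < w)%N /\ supp (fun a => lo <= a 0 j <= lo + w.-1%:Z) x.
Proof.
move=> sx x0 nx; have H a : coef x a != 0 -> lo <= a 0 j < lo + w%:Z.
  move=> xa; have /andP[-> le2] := sx _ xa; rewrite /= lt_neqAle le2 andbT; apply/eqP => E.
  have := coef_proj (fun a => a 0 j == lo + w%:Z) x a.
  by rewrite -/(hcomp _ _ _) x0 coef0 E eqxx => /esym/eqP; rewrite (negPf xa).
have [a xa] := neq0_coef nx; split; first by have := H _ xa; lia.
by move=> b /H; have := H _ xa; move: (a 0 j) (b 0 j) => p q; lia.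
Qed.

(* Pseudo-division by an element of P that has minimal width in coordinate j
   among the elements homogeneous in the coordinates beyond j. *)
Lemma min_prime_pseudo_div (j : 'I_n) f w :
  P f -> f <> 0 -> hom j.+1 f -> (exists lo, supp (fun a => lo <= a 0 j <= lo + w%:Z) f) ->
  (forall w' g, P g -> g <> 0 -> hom j.+1 g ->
     (exists lo, supp (fun a => lo <= a 0 j <= lo + w'%:Z) g) -> (w <= w')%N) ->
  forall w' g, P g -> hom j.+1 g -> (exists lo, supp (fun a => lo <= a 0 j <= lo + w'%:Z) g) ->
    exists u, [/\ u <> 0, hom j u & exists r, u * g = r * f].
Proof.
move=> Pf nf hf [lo sf] wmin; elim/ltn_ind => w' IH g Pg hg [lo' sg].
have triv : exists u : A, [/\ u <> 0, hom j u & exists r, u * 0 = r * f].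
  exists 1; split; first by apply/eqP; exact: oner_neq0.
    by rewrite -e0; exact: hom_e.
  by exists 0; rewrite mulr0 mul0r.
have [->//|/eqP ng] := eqVneq g 0.
have ww' : (w <= w')%N by apply: wmin ng hg _ => //; exists lo'.
pose X := fun a : 'rV[int]_n => a 0 j.
set ft := hcomp X (lo + w%:Z) f; set gt := hcomp X (lo' + w'%:Z) g.
have nft : ft <> 0.
  move=> ft0; have [w0 sf'] := width_top sf ft0 nf.
  by have := wmin w.-1 f Pf nf hf (ex_intro _ lo sf'); lia.
have hft : hom j ft by exact: hom_hcomp.
have sft : supp (fun a => X a = lo + w%:Z) ft by apply: (supp_sub (supp_proj _ _)) => a _ /eqP.
have sgt : supp (fun a => X a = lo' + w'%:Z) gt by apply: (supp_sub (supp_proj _ _)) => a _ /eqP.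
pose g' := ft * g - gt * f.
have Pg' : P g' by apply: primeB => //; apply: primeMl.
have hg' : hom j.+1 g'.
  case: hf hg => [v hf] [v' hg]; exists (v + v'); apply: suppB.
    by apply: hom_at_mul => //; exact: supp_proj2.
  by rewrite addrC; apply: hom_at_mul => //; exact: supp_proj2.
(* [ft] and [gt] sit in single degrees, so [g'] is no wider than [g], given [w <= w']; its top then
   cancels, and the width drops. *)
have sg' : supp (fun a => lo + lo' + w%:Z <= a 0 j <= lo + lo' + w%:Z + w'%:Z) g'.
  apply: suppB.
    apply: (supp_mul sft sg) => a b _ _; rewrite /X mxE; move: (a 0 j) (b 0 j) => p q; lia.
  apply: (supp_mul sgt sf) => a b _ _; rewrite /X mxE; move: (a 0 j) (b 0 j) => p q; lia.
have tg' : hcomp X (lo + lo' + w%:Z + w'%:Z) g' = 0.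
  rewrite /hcomp /g' -[- _]mulN1r projD mulN1r -scaleN1r projZ scaleN1r.
  have E1 : lo + lo' + w%:Z + w'%:Z = (lo + w%:Z) + (lo' + w'%:Z) by lia.
  have E2 : lo + lo' + w%:Z + w'%:Z = (lo' + w'%:Z) + (lo + w%:Z) by lia.
  rewrite {1}E1 E2 -!/(hcomp X _ _) !hcompM_top.
  - rewrite [hcomp X _ ft]proj_supp; last by apply: (supp_sub sft) => a _ ->.
    rewrite [hcomp X _ gt]proj_supp; last by apply: (supp_sub sgt) => a _ ->.
    by rewrite mulrC subrr.
  - exact: coord_additive.
  - by apply: (supp_sub sgt) => a _ ->.
  - by apply: (supp_sub sf) => a _ /andP[].
  - exact: coord_additive.
  - by apply: (supp_sub sft) => a _ ->.
  - by apply: (supp_sub sg) => a _ /andP[].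
have [u [nu hu [r Er]]] : exists u : A, [/\ u <> 0, hom j u & exists r, u * g' = r * f].
  have [->//|/eqP ng'] := eqVneq g' 0.
  have [w'0 sg''] := width_top sg' tg' ng'.
  by apply: (IH w'.-1) => //; [lia | exists (lo + lo' + w%:Z)].
exists (u * ft); split; [exact: mul_neq0 | exact: hom_mul|].
exists (r + u * gt); rewrite mulrDl -Er /g'; ring.
Qed.

(* i is the least number such that P contains a nonzero element homogeneous in the coordinates i, ..., n - 1. For
   i = 0 this is a monomial. For i > 0 the leading coefficients of pseudo-division in coordinate i - 1 are homogeneous
   in the coordinates from i - 1 on, hence outside P. *)
Lemma min_prime_dichotomy :
  (forall x a, P x -> coef x a != 0 -> P (e a)) \/ loc_principal P.
Proof.
pose Qn i := `[< exists x, [/\ P x, x <> 0 & hom i x] >].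
have exQ : exists i, Qn i.
  by case: (Pm) => _ [x [Px nx]] _; exists n; apply/asboolP; exists x; split=> //; exact: hom_full.
case: (ex_minnP exQ) => i /asboolP [y [Py ny hy]] imin.
have ilen : (i <= n)%N.
  by apply: imin; apply/asboolP; exists y; split=> //; exact: hom_full.
case: i => [|i] in hy imin ilen *.
  left=> x a Px; apply: (min_prime_hom_ind (K := fun x => coef x a != 0 -> P (e a)) ilen Py ny hy) => //.
  - by rewrite coef0 eqxx.
  - move=> x1 x2 H1 H2; rewrite coefD; have [->|] := eqVneq (coef x1 a) 0; first by rewrite add0r.
    by move=> ? _; exact: H1.
  move=> {Px}x Px hx xa; have nx : x <> 0 by move=> E; rewrite E coef0 eqxx in xa.
  have [b [Sb xb Eb]] := hom0E hx nx.
  have -> : a = b.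
    by move: xa; rewrite Eb coefZ (coef_e _ Sb); case: (a =P b) => //; rewrite mulr0 eqxx.
  have -> : e b = (coef x b)^-1 *: x by rewrite {2}Eb scalerA mulVf ?scale1r.
  exact: primeZ.
right; pose j := Ordinal ilen.
have nhom x : P x -> x <> 0 -> ~ hom j x.
  move=> Px nx hx; have : (i.+1 <= i)%N by apply: imin; apply/asboolP; exists x.
  by rewrite ltnn.
pose Wn w := `[< exists x, [/\ P x, x <> 0, hom i.+1 x &
  exists lo, supp (fun a => lo <= a 0 j <= lo + w%:Z) x] >].
have exW : exists w, Wn w.
  have [w [lo sy]] := hom_width j y.
  by exists w; apply/asboolP; exists y; split=> //; exists lo.
case: (ex_minnP exW) => w /asboolP [f [Pf nf hf sf]] wmin.
exists f; split=> //.
apply: (min_prime_hom_ind (K := fun g => exists u, ~ P u /\ exists r, u * g = r * f) ilen Py ny hy).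
- by exists 1; split; [exact: prime1 Pp | exists 0; rewrite mul0r mulr0].
- move=> x z [u [nu [r Er]]] [u' [nu' [r' Er']]]; exists (u * u'); split; first exact: prime_notM.
  exists (u' * r + u * r').
  by rewrite mulrDr mulrDl -!mulrA -Er -Er'; ring.
move=> g Pg hg; have [w' [lo sg]] := hom_width j g.
have [||u [nu hu Hr]] := @min_prime_pseudo_div j f w Pf nf hf sf _ w' g Pg hg.
- move=> w1 g1 Pg1 ng1 hg1 sg1; apply: wmin; apply/asboolP; exists g1; split=> //.
- by exists lo.
by exists u; split=> // Pu; exact: nhom Pu nu hu.
Qed.

End MinimalPrime.

(** * Face ideals, and the condition on primes of height at most one *)

Definition face_ideal (f : 'rV[int]_n -> int) x := supp (fun a => f a != 0) x.

(** The part on the face is the top part for [- f], hence multiplicative; in a domain a product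
    without such a part has a factor without one. *)
Lemma face_ideal_prime f : additive_deg f -> (forall a, S a -> 0 <= f a) -> is_prime (face_ideal f).
Proof.
move=> fD f_ge0; split.
- split; [exact: supp0 | by move=> x y; exact: suppD|].
  move=> r x Hx; apply: (@supp_mul (fun=> True) _ _ r x _ Hx) => // a b Sa Sb _ /eqP fb.
  have := f_ge0 _ Sa; have := f_ge0 _ Sb; rewrite fD; lia.
- have f0 : f 0 = 0 by have := fD 0 0; rewrite addr0; lia.
  by move/(_ 0); rewrite -e0 (coef_e _ S0) eqxx oner_neq0 f0 eqxx => /(_ isT).
move=> x y Hxy; pose g a := - f a.
have gD : additive_deg g by move=> a b; rewrite /g fD opprD.
have sg z : supp (fun a => g a <= 0) z.
  by move=> a /coef_neq0 /f_ge0; rewrite /g; lia.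
have := hcompM_top gD (sg x) (sg y); rewrite addr0.
rewrite [LHS]proj_suppC; last first.
  by apply: (supp_sub Hxy) => a _; rewrite /g oppr_eq0 => /negP.
have key z : hcomp g 0 z = 0 -> face_ideal f z.
  move=> E a za; apply/negP => fa; have := coef_proj (fun a => g a == 0) z a.
  by rewrite -/(hcomp _ _ _) E coef0 /g oppr_eq0 fa => /esym/eqP; apply/negP.
move=> E; apply: contrapT => /not_orP [nx ny]; apply: (mul_neq0 _ _ (esym E)) => /key; [exact: nx | exact: ny].
Qed.

Lemma zero_prime : is_prime (fun x : A => x = 0).
Proof.
split; [split=> [|x y ->->|r x ->] | exact/eqP/oner_neq0 |]; rewrite ?addr0 ?mulr0 //.
by move=> x y xy; apply: contrapT => /not_orP [nx ny]; exact: mul_neq0 nx ny xy.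
Qed.

Lemma prime_chain0 (P : A -> Prop) : is_prime P -> (exists x, P x /\ x <> 0) -> prime_chain P 1.
Proof.
move=> Pp [x [Px nx]]; exists (fun i => if i == 0%N then (fun y => y = 0) else P); split=> //.
- by case=> [|i] _ //; exact: zero_prime.
case=> // _; split=> /= [y ->|]; [exact: prime0 | by exists x].
Qed.

Lemma min_prime_chain_le (P : A -> Prop) m : min_prime P -> prime_chain P m -> (m <= 1)%N.
Proof.
case=> Pp _ Pmin [Q [QP Qp Qlt]]; rewrite leqNgt; apply/negP => m1.
have [m2 Em] : exists m2, m = m2.+2 by exists m.-2; lia.
subst m; have [sub [x [Qx nQx]]] := Qlt m2.+1 (ltnSn _).
have [_ [y [Qy nQy]]] := Qlt m2 (leqnSn m2.+1).
have Qp1 := Qp _ (leqnSn m2.+1).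
apply: nQx; apply: (Pmin _ Qp1) (iffLR (QP x) Qx) => //.
  by move=> z /sub /QP.
by exists y; split=> // y0; apply: nQy; rewrite y0; apply: prime0; apply: Qp; lia.
Qed.

(** In a domain height zero means the zero ideal, generated by the empty list, and height one means
    minimal among nonzero primes. There one generator is required, and the empty list is too short
    because [P] is nonzero. *)
Lemma serre_R1_min_prime : serre_R1 A <-> (forall P, min_prime P -> loc_principal P).
Proof.
split=> [R1 P Pm | H P Pp [m [m1 [Pc nPc]]]].
  have [Pp Pn _] := Pm.
  have [|m [[Pc nPc] [l [sl [lP lgen]]] _]] := R1 P Pp.
    exists 1%N; split=> //; split; first exact: prime_chain0.
    by move/(min_prime_chain_le Pm).
  have m_le := min_prime_chain_le Pm Pc.
  case: m => [|m] in Pc nPc sl m_le; first by case: nPc; exact: prime_chain0.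
  case: l sl lP lgen => [|f [|? ?]] /= sl lP lgen; [lia| |lia].
  exists f; split; first by apply: lP; exact: mem_head.
  move=> g /lgen [u [nu [r [_ E]]]]; exists u; split=> //; exists r`_0.
  by move: E; rewrite big_ord1.
case: m => [|[|//]] in m1 Pc nPc *.
  have P0 x : P x -> x = 0.
    by move=> Px; apply: contrapT => nx; apply: nPc; apply: prime_chain0 => //; exists x.
  exists 0%N; split=> //; exists [::]; split=> //; split=> // x /P0->.
  by exists 1; split; [exact: prime1 | exists [::]; rewrite big_ord0 mulr0].
have [x [Px nx]] : exists x, P x /\ x <> 0.
  case: Pc => Q [QP Qp Qlt]; have [_ [x [Qx nQx]]] := Qlt 0%N isT.
  by exists x; split; [exact/QP | move=> x0; apply: nQx; rewrite x0; apply: prime0; exact: Qp].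
have /H [f [Pf fP]] : min_prime P.
  split=> //; first by exists x.
  move=> Q Qp QP [y [Qy ny]] z Pz; apply: contrapT => nQz; apply: nPc.
  exists (fun i => if i == 0%N then (fun y => y = 0) else if i == 1%N then Q else P); split=> //.
  - by case=> [|[|i]] _ //; exact: zero_prime.
  - case=> [|[|//]] _ /=; split=> //; last by exists z.
      by move=> w ->; exact: prime0.
    by exists y.
exists 1%N; split=> //.
  exists [:: f]; split=> //; split; first by move=> g; rewrite inE => /eqP->.
  move=> g /fP [u [nu [r E]]]; exists u; split=> //; exists [:: r]; split=> //.
  by rewrite big_ord1.
move=> [|g l] // [_ /(_ _ Px) [u [nu [r [_]]]]]; rewrite big_ord0 => E.
by case: (mul_neq0 _ nx E) => u0; apply: nu; rewrite u0; exact: prime0.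
Qed.

(** Elements that some factor outside [P] turns into multiples of [e b] are closed under sums, so
    the monomials of [P] suffice. *)
Lemma loc_principal_monomial (P : A -> Prop) b : is_prime P ->
  (forall x a, P x -> coef x a != 0 -> P (e a)) -> S b -> P (e b) ->
  (forall a, S a -> P (e a) -> exists c t, [/\ S c, S t, ~ P (e c) & a + c = b + t]) ->
  loc_principal P.
Proof.
move=> Pp Pmon Sb Pb H; exists (e b); split=> // g Pg.
rewrite (msuppE g) big_seq.
apply: (big_ind (fun y => exists u, ~ P u /\ exists r, u * y = r * e b)).
- by exists 1; split; [exact: prime1 | exists 0; rewrite mul0r mulr0].
- move=> x z [u [nu [r Er]]] [u' [nu' [r' Er']]]; exists (u * u'); split; first exact: prime_notM.
  exists (u' * r + u * r').
  by rewrite mulrDr mulrDl -!mulrA -Er -Er'; ring.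
move=> a ag; have Sa := msuppS ag; rewrite mem_msupp in ag.
have [c [t [Sc St nPc E]]] := H a Sa (Pmon _ _ Pg ag).
exists (e c); split=> //; exists (coef g a *: e t).
by rewrite -scalerAr -scalerAl -!eD // [c + a]addrC E [t + b]addrC.
Qed.

(** The part of [w] of the wrong parity, times [r], has the wrong parity, but it is also a
    difference of two elements of parity [beta]. So it is zero, and [r] cancels. *)
Lemma supp_cancel_parity (chi : 'rV[int]_n -> bool) (beta : bool) (u v r w : A) :
  (forall a b, chi (a + b) = chi a (+) chi b) ->
  supp (fun a => ~~ chi a) u -> supp (fun a => ~~ chi a) r -> u * v = r * w ->
  supp (fun a => chi a == beta) v -> u <> 0 -> v <> 0 -> supp (fun a => chi a == beta) w.
Proof.
move=> chiD su sr E sv nu nv.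
pose T a := chi a == beta.
have nr : r <> 0 by move=> r0; apply: (mul_neq0 nu nv); rewrite E r0 mul0r.
have Z : r * proj (predC T) w = 0.
  apply: (@supp_disj T); last first.
    apply: (supp_mul sr (supp_proj (predC T) w)) => a b _ _ /= na.
    by rewrite /T chiD (negPf na) addFb => /negP.
  have -> : r * proj (predC T) w = u * v - r * proj T w.
    by rewrite E {2}(projC T w) mulrDr addrC addKr.
  apply: suppB.
    by apply: (supp_mul su sv) => a b _ _ /= na; rewrite /T chiD (negPf na) addFb.
  by apply: (supp_mul sr (supp_proj T w)) => a b _ _ /= na; rewrite /T chiD (negPf na) addFb.
have w0 : proj (predC T) w = 0 by apply: contrapT => nw; exact: mul_neq0 nr nw Z.
by rewrite (projC T w) w0 addr0; exact: supp_proj.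
Qed.

(** For a local generator [x], the lowest parts in [u * e a = r * x] relate [e a] to the degree-one
    part of [x] by factors on the face. Such factors have even parity, so this part has the parity
    of [a], for [a1] and [a2] alike. *)
Lemma face_ideal_not_principal (f : 'rV[int]_n -> int) (chi : 'rV[int]_n -> bool) a1 a2 :
  additive_deg f -> (forall a, S a -> 0 <= f a) ->
  (forall a b, chi (a + b) = chi a (+) chi b) -> (forall a, S a -> f a = 0 -> ~~ chi a) ->
  S a1 -> S a2 -> f a1 = 1 -> f a2 = 1 -> chi a1 != chi a2 -> ~ loc_principal (face_ideal f).
Proof.
move=> fD f_ge0 chiD chi0 Sa1 Sa2 fa1 fa2 nchi [x [Px Hx]].
pose g a := - f a.
have gD : additive_deg g by move=> a b; rewrite /g fD opprD.
have sg z : supp (fun a => g a <= 0) z.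
  by move=> a /coef_neq0 /f_ge0; rewrite /g; lia.
have sP z : face_ideal f z -> supp (fun a => g a <= -1) z.
  by move=> Pz a za; have := Pz a za; have := f_ge0 _ (coef_neq0 za); rewrite /g; lia.
have s0 z : supp (fun a => ~~ chi a) (hcomp g 0 z).
  apply: (supp_sub (supp_proj _ z)) => a Sa /= /eqP ga; apply: chi0 => //.
  by move: ga; rewrite /g; lia.
pose y := hcomp g (-1) x.
have key a : S a -> f a = 1 -> y <> 0 /\ supp (fun b => chi b == chi a) y.
  move=> Sa fa; have Pa : face_ideal f (e a) by apply: supp_e => //; rewrite fa.
  have [u [nu [r E]]] := Hx _ Pa.
  have := hcompM_top gD (sg u) (sP _ Pa); rewrite E (hcompM_top gD (sg r) (sP _ Px)) -/y.
  rewrite [hcomp g (-1) (e a)]proj_supp; last by apply: supp_e => //; rewrite /g fa.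
  move=> E'; have nu0 : hcomp g 0 u <> 0.
    move=> u0; apply: nu => b ub; apply/negP => /eqP fb.
    have := coef_proj (fun a => g a == 0) u b.
    by rewrite -/(hcomp _ _ _) u0 coef0 /g fb oppr0 eqxx => /esym/eqP; apply/negP.
  have na := e_neq0 Sa.
  split; last by apply: supp_cancel_parity chiD (s0 u) (s0 r) (esym E') (supp_e Sa _) nu0 na.
  by move=> y0; apply: (mul_neq0 nu0 na); rewrite -E' y0 mulr0.
have [ny s1] := key _ Sa1 fa1; have [_ s2] := key _ Sa2 fa2.
have [a ya] := neq0_coef ny; move: nchi.
by rewrite -(eqP (s1 _ ya)) (eqP (s2 _ ya)) eqxx.
Qed.

(* x is replaced by x (x_0 - x_1) = x_0 ^ 2 - x_1 ^ 2, where x_0 and x_1 are its parts of even and odd parity;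
   unlike a norm over a group of characters, this needs no root of unity and no hypothesis on the characteristic. *)
Lemma even_multiple (T : 'rV[int]_n -> Prop) (chi : 'rV[int]_n -> bool) x :
  (forall a b, T a -> T b -> T (a + b)) ->
  (forall a b, T a -> T b -> chi (a + b) = chi a (+) chi b) -> x <> 0 -> supp T x ->
  exists y, x * y <> 0 /\ supp (fun a => T a /\ ~~ chi a) (x * y).
Proof.
move=> TD chiD nx sx.
pose x1 := proj chi x; pose x0 := proj (predC chi) x; exists (x0 - x1).
have s1 : supp (fun a => T a /\ chi a) x1.
  by move=> a xa; split; [exact: supp_proj2 sx _ xa | exact: (supp_proj chi x)].
have s0 : supp (fun a => T a /\ ~~ chi a) x0.
  by move=> a xa; split; [exact: supp_proj2 sx _ xa | exact: (supp_proj (predC chi) x)].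
split; last first.
  have -> : x * (x0 - x1) = x0 * x0 - x1 * x1 by rewrite {1}(projC chi x) -/x1 -/x0; ring.
  apply: suppB.
    apply: (supp_mul s0 s0) => a b _ _ [Ta na] [Tb nb]; split; first exact: TD.
    by rewrite chiD // (negPf na) (negPf nb).
  apply: (supp_mul s1 s1) => a b _ _ [Ta na] [Tb nb]; split; first exact: TD.
  by rewrite chiD // na nb.
apply: mul_neq0 => // /eqP; rewrite subr_eq0 => /eqP E; apply: nx.
have x10 : x1 = 0.
  apply: (@supp_disj chi); first exact: supp_proj.
  by rewrite -E; apply: (supp_sub s0) => a _ [_ /negP].
by rewrite (projC chi x) -/x1 -/x0 E x10 addr0.
Qed.

Lemma odd_dvdzD (p q : int) : ~~ (2 %| p + q)%Z = ~~ (2 %| p)%Z (+) ~~ (2 %| q)%Z.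
Proof. lia. Qed.

(** Even exponents are wanted because membership in the lattice of a face is obstructed by parities;
    the coordinates are treated one by one. *)
Lemma even_coords_multiple (l : seq 'I_n) (x : A) : x <> 0 ->
  exists y, x * y <> 0 /\ supp (fun a : 'rV[int]_n => forall j, j \in l -> (2 %| a ord0 j)%Z) (x * y).
Proof.
move=> nx; elim: l => [|j l [y [nxy sxy]]]; first by exists 1; rewrite mulr1.
have [| |z [nz sz]] := @even_multiple _ (fun a => ~~ (2 %| a ord0 j)%Z) (x * y) _ _ nxy sxy.
- by move=> a b Ha Hb i il; rewrite mxE rpredD ?Ha ?Hb.
- by move=> a b _ _; rewrite mxE odd_dvdzD.
exists (y * z); rewrite mulrA; split=> //; apply: (supp_sub sz) => a _ [Ha Hj] i.
by rewrite inE => /predU1P[->|/Ha //]; rewrite negbK in Hj.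
Qed.

(* If a smaller prime Q misses some e b with b off the face, take x in Q nonzero and even enough: its lowest part in
   degree f can be divided by a power of e b, up to a monomial of the face, and the quotient lies in Q but not in the
   face ideal. *)
Lemma face_ideal_min_prime (f : 'rV[int]_n -> int) (gen : 'rV[int]_n -> Prop) :
  additive_deg f -> (forall a, S a -> 0 <= f a) ->
  (forall a : 'rV[int]_n, (forall j, (2 %| a ord0 j)%Z) -> (2 %| f a)%Z) ->
  (exists2 a, S a & f a != 0) ->
  (forall b, gen b -> [/\ S b, 0 < f b & f b <= 2]) ->
  (forall a, S a -> f a != 0 -> exists b a', [/\ gen b, S a' & a = b + a']) ->
  (forall (a b : 'rV[int]_n) (t : nat), S a -> gen b -> (forall j, (2 %| a ord0 j)%Z) -> ~~ odd t -> f a = f b * t%:Z ->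
     exists c c', [/\ S c, S c', f c = 0, f c' = 0 & a + c = b *+ t + c']) ->
  min_prime (face_ideal f).
Proof.
move=> fD f_ge0 f_even [a0 Sa0 fa0] genP gen_ex Hlat.
have f0 : f 0 = 0 by have := fD 0 0; rewrite addr0; lia.
split; first exact: face_ideal_prime.
  by exists (e a0); split; [exact: supp_e | exact: e_neq0].
move=> Q Qp QP [x [Qx nx]] z Pz; apply: contrapT => nQz.
have [a [Sa fa nQa]] : exists a, [/\ S a, f a != 0 & ~ Q (e a)].
  apply: contrapT => H; apply: nQz; rewrite (msuppE z); apply: prime_sum => // a.
  rewrite mem_msupp => za; apply: primeZ => //; apply: contrapT => nQa; apply: H.
  by exists a; split=> //; [exact: coef_neq0 za | exact: Pz].
have [b [a' [gb Sa' Ea]]] := gen_ex a Sa fa; have [Sb fb fb2] := genP b gb.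
have nQb : ~ Q (e b) by move=> Qb; apply: nQa; rewrite Ea eD //; exact: primeMr.
have SX t : S (b *+ t).
  by elim: t => [|t IH]; rewrite ?mulr0n // mulrS; exact: SD.
have fX t : f (b *+ t) = f b * t%:Z.
  elim: t => [|t IH]; first by rewrite mulr0n f0 mulr0.
  by rewrite mulrS fD IH; lia.
have nQX t : ~ Q (e (b *+ t)).
  elim: t => [|t IH]; first by rewrite mulr0n e0; exact: prime1.
  by rewrite mulrS eD //; exact: prime_notM.
have [y1 [nx1 s1]] := even_coords_multiple (enum 'I_n) nx.
(* This makes [f] divisible by 4 on the exponents, hence an even multiple of [f b], whether [f b] is
   1 or 2. *)
have [| | |y2 [nx2 s2]] := @even_multiple (fun a : 'rV[int]_n => forall j, (2 %| a ord0 j)%Z)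
    (fun a => ~~ (2 %| (f a %/ 2)%Z)%Z) (x * y1) _ _ nx1 _.
- by move=> c d Hc Hd j; rewrite mxE rpredD.
- move=> c d /f_even Hc /f_even Hd; rewrite fD -odd_dvdzD; congr (~~ (2 %| _)%Z); lia.
- by apply: (supp_sub s1) => c _ Hc j; apply: Hc; rewrite mem_enum.
set X := x * y1 * y2 in nx2 s2.
have QX : Q X by apply: primeMr => //; apply: primeMr.
have X4 c : coef X c != 0 -> exists2 t : nat, ~~ odd t & f c = f b * t%:Z.
  move=> Xc; have [/f_even H2 H4] := s2 _ Xc; have := f_ge0 _ (coef_neq0 Xc).
  have [fb1|fb1] : f b = 1 \/ f b = 2 by lia.
    by exists (absz (f c)); rewrite ?fb1; lia.
  by exists (absz (f c %/ 2)%Z); rewrite ?fb1; lia.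
have [m [nXm sm]] := hcomp_top (fun a => - f a) nx2.
have [d Hd] := neq0_coef nXm.
move: Hd; rewrite coef_proj; case: (- f d =P m) => [fd Xd|]; last by rewrite eqxx.
have [t ot ft] := X4 d Xd.
(* No exponent of [X] has smaller degree than [d], so each monomial times a suitable face monomial
   is divisible by [e (b *+ t)]. *)
have [C [Z [SC fC EZ]]] : exists C Z, [/\ S C, f C = 0 & e C * X = e (b *+ t) * Z].
  rewrite (msuppE X) big_seq.
  apply: (big_ind (fun y => exists C Z, [/\ S C, f C = 0 & e C * y = e (b *+ t) * Z])).
  - by exists 0, 0; rewrite !mulr0.
  - move=> y y' [C [Z [SC fC E]]] [C' [Z' [SC' fC' E']]].
    exists (C + C'), (e C' * Z + e C * Z'); split; [exact: SD | by rewrite fD fC fC'|].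
    have -> : e (C + C') * (y + y') = e C' * (e C * y) + e C * (e C' * y') by rewrite eD //; ring.
    by rewrite E E'; ring.
  move=> c; rewrite mem_msupp => Xc; have [t' ot' ft'] := X4 c Xc.
  have tt' : (t <= t')%N.
    have := sm c Xc; rewrite -fd ft' ft lerN2 ler_pM2l //; lia.
  have [Hc _] := s2 _ Xc.
  have [C [C' [SC SC' fC fC' E]]] := Hlat c b t' (coef_neq0 Xc) gb Hc ot' ft'.
  exists C, (coef X c *: e (b *+ (t' - t) + C')); split=> //.
  rewrite -!scalerAr -!eD //; [|exact: SD|exact: coef_neq0 Xc].
  by rewrite [C + c]addrC E addrA -mulrnDr subnKC.
have QZ : Q Z.
  have : Q (e (b *+ t) * Z) by rewrite -EZ; exact: primeMl.
  by case/(primeM Qp) => // /nQX.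
(* The monomial [d + C] of [e C * X] has degree [f b * t], which does not occur in the product of
   [e (b *+ t)] with an element of the face ideal. *)
have := supp_mul (supp_e (T := fun a => a = b *+ t) (SX t) erefl) (QP _ QZ).
move/(_ (fun a => f a != f b * t%:Z)); rewrite -EZ => H.
have : f (d + C) != f b * t%:Z.
  apply: H; last by rewrite coef_eM // addrK.
  move=> p q Sp Sq -> fq; rewrite fD fX; move: fq; apply: contraNN; lia.
by rewrite fD fC addr0 ft eqxx.
Qed.

(** Otherwise the face ideal of [f] would be a nonzero prime inside [P], hence all of [P], although
    it misses [e b]. This is how minimality of the prime makes its face maximal. *)
Lemma min_prime_face (P : A -> Prop) (f : 'rV[int]_n -> int) b : min_prime P ->
  additive_deg f -> (forall a, S a -> 0 <= f a) -> (forall a, S a -> f a != 0 -> P (e a)) ->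
  S b -> P (e b) -> f b = 0 -> forall a, S a -> f a = 0.
Proof.
move=> [Pp _ Pmin] fD f_ge0 fP Sb Pb fb a Sa; apply/eqP/negPn/negP => fa.
suff : face_ideal f (e b).
  by move/(_ b); rewrite (coef_e _ Sb) eqxx oner_neq0 fb eqxx => /(_ isT).
apply: (Pmin (face_ideal f)) Pb; first exact: face_ideal_prime.
  move=> x Hx; rewrite (msuppE x); apply: prime_sum => // c; rewrite mem_msupp => xc.
  by apply: primeZ => //; apply: fP (Hx _ xc); exact: coef_neq0 xc.
by exists (e a); split; [exact: supp_e | exact: e_neq0].
Qed.

Lemma monomial_prime_ex (P : A -> Prop) : min_prime P ->
  (forall x a, P x -> coef x a != 0 -> P (e a)) -> exists2 a, S a & P (e a).
Proof.
move=> [_ [x [Px nx]] _] Pmon; have [a xa] := neq0_coef nx.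
by exists a; [exact: coef_neq0 xa | exact: Pmon Px xa].
Qed.

End MonomialBasis.

(** * Height-one primes of edge rings *)

Section EdgeSemigroup.
Variables (n : nat) (s : 'I_n -> 'I_n -> int).
Hypothesis sG : signed_graph s.

Lemma rho_sym i j : rho s i j = rho s j i.
Proof. by rewrite !rhoE (signed_sym sG) [_ + delta_mx _ j]addrC. Qed.

Lemma in_semigroup0 : in_semigroup s 0.
Proof. by exists (fun _ _ => 0%N); rewrite big1 // => i _; rewrite big1. Qed.

Lemma in_semigroupD a b : in_semigroup s a -> in_semigroup s b -> in_semigroup s (a + b).
Proof.
move=> [m ->] [m' ->]; exists (fun i j => m i j + m' i j)%N.
rewrite -big_split; apply: eq_bigr => i _; rewrite -big_split; apply: eq_bigr => j _.
by rewrite mulrnDr.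
Qed.

Lemma in_semigroupMn a t : in_semigroup s a -> in_semigroup s (a *+ t).
Proof.
move=> Sa; elim: t => [|t IH]; first by rewrite mulr0n; exact: in_semigroup0.
by rewrite mulrS; exact: in_semigroupD.
Qed.

Lemma in_semigroup_rho i j : in_semigroup s (rho s i j).
Proof.
wlog ij : i j / (i <= j)%N.
  by move=> H; have [/H //|/ltnW /H] := leqP i j; rewrite rho_sym.
exists (fun i' j' => ((i' == i) && (j' == j) : nat)).
rewrite (bigD1 i) //= (bigD1 j) //= !eqxx mulr1n !big1 ?addr0 //.
  by move=> i' /negPf i'i; rewrite big1 // => j' _; rewrite i'i mulr0n.
by move=> j' /andP[_ /negPf j'j]; rewrite j'j andbF mulr0n.
Qed.

Lemma in_semigroup_ind (K : 'rV[int]_n -> Prop) a : K 0 ->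
  (forall b c, in_semigroup s b -> in_semigroup s c -> K b -> K c -> K (b + c)) ->
  (forall i j, s i j != 0 -> K (rho s i j)) -> in_semigroup s a -> K a.
Proof.
move=> K0 KD Kr.
pose K' b := in_semigroup s b /\ K b.
have K'0 : K' 0 by split => //; exact: in_semigroup0.
have K'D b c : K' b -> K' c -> K' (b + c).
  by move=> [Sb Kb] [Sc Kc]; split; [exact: in_semigroupD | exact: KD].
have K'r i j : K' (rho s i j).
  split; first exact: in_semigroup_rho.
  by have [s0|/Kr //] := eqVneq (s i j) 0; rewrite rhoE s0 mulr0z.
suff H : in_semigroup s a -> K' a by move=> /H [].
move=> [m ->]; apply: (big_ind K') => // i _; apply: (big_ind K') => // j _.
by elim: (m i j) => [|t IH]; rewrite ?mulr0n // mulrS; exact: K'D.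
Qed.

Lemma dot_additive v : additive_deg (@dot n v).
Proof. by move=> a b; exact: dotD. Qed.

Lemma dot_semigroup_ge0 v a : (forall i j, s i j != 0 -> 0 <= dot v (rho s i j)) ->
  in_semigroup s a -> 0 <= dot v a.
Proof.
move=> H; apply: (in_semigroup_ind (K := fun a => 0 <= dot v a)) => [|b c _ _ b0 c0|//]; first by rewrite dot0.
by rewrite dotD addr_ge0.
Qed.

Lemma balanced_dot v i j : balanced s v -> dot v (rho s i j) = 0.
Proof.
move=> bv; rewrite dot_rho; have [->|/bv ->] := eqVneq (s i j) 0; first by rewrite mul0r.
by rewrite mulr0.
Qed.

Lemma balanced_dot_semigroup v a : balanced s v -> in_semigroup s a -> dot v a = 0.
Proof.
move=> bv; apply: (in_semigroup_ind (K := fun a => dot v a = 0)) => [|b c _ _ b0 c0|i j _]; first by rewrite dot0.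
  by rewrite dotD b0 c0.
exact: balanced_dot.
Qed.

Lemma dot_even v (a : 'rV[int]_n) : (forall j, (2 %| a ord0 j)%Z) -> (2 %| dot v a)%Z.
Proof. by move=> Ha; apply: rpred_sum => j _; rewrite dvdz_mull. Qed.

End EdgeSemigroup.

Lemma min_ratio (T : finType) (Q : pred T) (u w : T -> int) x0 : Q x0 -> (forall x, Q x -> 0 < w x) ->
  exists2 x, Q x & forall y, Q y -> u x * w y <= u y * w x.
Proof.
move=> Qx0 wpos; pose F x : rat := (u x)%:~R / (w x)%:~R.
case: (arg_minP F Qx0) => x Qx xmin; exists x => // y Qy.
have := xmin y Qy; rewrite /F ler_pdivrMr ?ltr0z ?wpos // mulrAC ler_pdivlMr ?ltr0z ?wpos //.
by rewrite -!intrM ler_int.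
Qed.

Section EdgeRing.
Variables (k : fieldType) (n : nat) (s : 'I_n -> 'I_n -> int).
Variables (A : comAlgType k) (e : 'rV[int]_n -> A).
Hypotheses (sG : signed_graph s) (He : is_edge_ring s e).

Let e0 : e 0 = 1. Proof. by case: He. Qed.
Let eD a b : in_semigroup s a -> in_semigroup s b -> e (a + b) = e a * e b.
Proof. by case: He => _ H _ _; exact: H. Qed.
Let e_free : forall l : seq ('rV[int]_n * k),
  uniq (map fst l) -> (forall p, p \in l -> in_semigroup s p.1) ->
  \sum_(p <- l) p.2 *: e p.1 = 0 -> forall p, p \in l -> p.2 = 0.
Proof. by case: He. Qed.
Let e_span : forall x : A, exists l : seq ('rV[int]_n * k),
  (forall p, p \in l -> in_semigroup s p.1) /\ x = \sum_(p <- l) p.2 *: e p.1.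
Proof. by case: He. Qed.
Let S0 := in_semigroup0 s.
Let SD := @in_semigroupD n s.
Let SX := @in_semigroupMn n s.
Let Sr := in_semigroup_rho sG.

(** * From a prime spanned by monomials to a facet subgraph *)

Section MonomialPrime.
Variable P : A -> Prop.
Hypothesis Pm : min_prime P.
Hypothesis Pmon : forall x a, P x -> coef e_span x a != 0 -> P (e a).
Let Pp : is_prime P. Proof. by case: Pm. Qed.

Definition prime_graph i j : int := if `[< P (e (rho s i j)) >] then 0 else s i j.
Local Notation h := prime_graph.

Lemma prime_graph_neq0 i j : h i j != 0 -> s i j != 0 /\ ~ P (e (rho s i j)).
Proof. by rewrite /h; case: asboolP; rewrite ?eqxx. Qed.

Lemma prime_graph_eq0 i j : s i j != 0 -> h i j = 0 -> P (e (rho s i j)).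
Proof. by rewrite /h; case: asboolP => // _ /eqP. Qed.

Lemma prime_graph_edge i j : P (e (rho s i j)) -> s i j != 0 /\ h i j = 0.
Proof.
rewrite /h; case: asboolP => // Pe _; split=> //; apply/eqP => s0; apply: (prime1 Pp).
by rewrite -e0; move: Pe; rewrite rhoE s0 mulr0z.
Qed.

Lemma prime_graph_sub : subgraph s h.
Proof.
apply/forallP => i; apply/forallP => j; rewrite /h (rho_sym sG j) (signed_sym sG j) eqxx /=.
by case: asboolP; rewrite ?eqxx ?orbT.
Qed.

Lemma prime_edge a : in_semigroup s a -> P (e a) ->
  exists i j a', [/\ in_semigroup s a', s i j != 0, h i j = 0 & a = rho s i j + a'].
Proof.
apply: (in_semigroup_ind sG (K := fun a => P (e a) -> exists i j a',
  [/\ in_semigroup s a', s i j != 0, h i j = 0 & a = rho s i j + a'])) => [|b c Sb Sc Hb Hc|i j sij Pe].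
- by rewrite e0 => /(prime1 Pp).
- rewrite eD // => /(primeM Pp) [/Hb|/Hc] [i [j [a' [Sa' sij hij ->]]]]; exists i, j.
    by exists (a' + c); rewrite addrA; split=> //; exact: SD.
  by exists (b + a'); rewrite addrCA; split=> //; exact: SD.
exists i, j, 0; rewrite addr0; split=> //.
by case: (prime_graph_edge Pe).
Qed.

Lemma prime_graph_face v a : (forall i j, h i j != 0 -> dot v (rho s i j) = 0) ->
  in_semigroup s a -> dot v a != 0 -> P (e a).
Proof.
move=> Hv; apply: (in_semigroup_ind sG (K := fun a => dot v a != 0 -> P (e a))) => [|b c Sb Sc Hb Hc|i j sij].
- by rewrite dot0 eqxx.
- rewrite dotD eD //; have [->|/Hb Pb _] := eqVneq (dot v b) 0; last exact: primeMr.
  by rewrite add0r => /Hc Pc; exact: primeMl.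
have [hij|/Hv ->] := eqVneq (h i j) 0; last by rewrite eqxx.
by move=> _; exact: prime_graph_eq0.
Qed.

Lemma prime_graph_extremal v p q : (forall i j, s i j != 0 -> 0 <= dot v (rho s i j)) ->
  (forall i j, h i j != 0 -> dot v (rho s i j) = 0) ->
  s p q != 0 -> h p q = 0 -> dot v (rho s p q) = 0 -> forall i j, dot v (rho s i j) = 0.
Proof.
move=> v_ge0 vh spq hpq vpq i j.
apply: (min_prime_face S0 SD e0 eD e_free e_span Pm (dot_additive v) _ _ (Sr p q) _ vpq (Sr i j)).
- by move=> a; exact: dot_semigroup_ge0.
- by move=> a; exact: prime_graph_face.
exact: prime_graph_eq0.
Qed.

(** Farkas' lemma for the cone of all edges and the negatives of the edges of [h], which consists of
    differences [t - f] with [e f] outside [P]. Were a positive multiple of minus a removed edge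
    such a difference, [f] would contain that edge and [e f] would lie in [P]. The separating
    functional cannot vanish at another removed edge, by [prime_graph_extremal]. *)
Lemma prime_graph_functional : exists v, [/\ forall i j, h i j != 0 -> dot v (rho s i j) = 0,
   (forall i j, s i j != 0 -> h i j = 0 -> 0 < dot v (rho s i j)) &
   exists p q, s p q != 0 /\ h p q = 0].
Proof.
have [a Sa Pa] := monomial_prime_ex e_free Pm Pmon.
have [p [q [_ [_ spq hpq _]]]] := prime_edge Sa Pa.
pose K a := exists t f, [/\ in_semigroup s t, in_semigroup s f, ~ P (e f) & a = t - f].
pose l1 := [seq rho s x.1 x.2 | x <- enum {: 'I_n * 'I_n}].
pose l2 := [seq - rho s x.1 x.2 | x <- enum {: 'I_n * 'I_n} & h x.1 x.2 != 0].
have K0 : K 0 by exists 0, 0; rewrite subrr e0; split; [exact: S0 | exact: S0 | exact: prime1 |].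
have KD b c : K b -> K c -> K (b + c).
  move=> [t [f [St Sf nf ->]]] [t' [f' [St' Sf' nf' ->]]]; exists (t + t'), (f + f').
  split; [exact: SD | exact: SD | by rewrite eD //; exact: prime_notM|].
  by rewrite opprD addrACA.
have Kl b : b \in l1 ++ l2 -> K b.
  rewrite mem_cat => /orP[/mapP [x _ ->]|/mapP [x]].
    by exists (rho s x.1 x.2), 0; rewrite e0 subr0; split; [exact: Sr | exact: S0 | exact: prime1 |].
  rewrite mem_filter => /andP[/prime_graph_neq0 [_ nx] _ ->].
  by exists 0, (rho s x.1 x.2); rewrite sub0r; split; [exact: S0 | exact: Sr | |].
have [v [vl vpq]] : exists v, (forall b, b \in l1 ++ l2 -> dot v b <= 0) /\ 0 < dot v (- rho s p q).
  apply: contrapT => nex.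
  have [v vl|N N0 [t [f [St Sf nPf E]]]] := @farkas _ K (l1 ++ l2) (- rho s p q) K0 KD Kl.
    by rewrite leNgt; apply/negP => vpq; apply: nex; exists v.
  apply: nPf; have -> : f = rho s p q *+ N + t.
    have -> : t = - rho s p q *+ N + f by rewrite E subrK.
    by rewrite mulNrn addrA subrr add0r.
  case: N N0 E => // N _ _; rewrite mulrS -addrA eD; [|exact: Sr|by apply: SD => //; exact: SX].
  by apply: primeMr => //; exact: prime_graph_eq0.
pose w i := - v i; have wE b : dot w b = - dot v b by exact: dot_oppl.
have w_ge0 i j : 0 <= dot w (rho s i j).
  rewrite wE oppr_ge0; apply: vl; rewrite mem_cat; apply/orP; left.
  by apply/mapP; exists (i, j); rewrite ?mem_enum.
have w_h i j : h i j != 0 -> dot w (rho s i j) = 0.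
  move=> hij; apply/eqP; rewrite eq_le w_ge0 andbT wE -dotN; apply: vl.
  rewrite mem_cat; apply/orP; right.
  by apply/mapP; exists (i, j) => //; rewrite mem_filter mem_enum andbT.
exists w; split=> //; last by exists p, q.
move=> i j sij hij; rewrite lt_neqAle w_ge0 andbT eq_sym; apply/eqP => wij.
have := prime_graph_extremal (fun i j _ => w_ge0 i j) w_h sij hij wij p q.
by rewrite wE -dotN => E; rewrite E ltxx in vpq.
Qed.

(* Subtract from the functional v of C the largest multiple of the supporting functional w that leaves it nonnegative:
   the difference vanishes at an edge off the face, hence everywhere since the face is maximal. So v is a multiple of w. *)
Lemma prime_graph_cuts C : is_new s h C -> exists g, cut s h C g.
Proof.
move=> /and3P[Ch /existsP [L /existsP [R LR]] nC].
have [w [w_h w_pos [p0 [q0 [s0 h0]]]]] := prime_graph_functional.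
have hS := sub_sym prime_graph_sub.
have [bv vC v1 _] := bipartition_sgv hS Ch LR; set v := sgv L R in bv vC v1.
pose Q (x : 'I_n * 'I_n) := (s x.1 x.2 != 0) && (h x.1 x.2 == 0).
have Q0 : Q (p0, q0) by rewrite /Q s0 h0 eqxx.
have [|[p q] /andP[/= spq /eqP hpq] pq_min] := min_ratio (fun x => dot v (rho s x.1 x.2))
    (w := fun x => dot w (rho s x.1 x.2)) Q0.
  by move=> x /andP[sx /eqP hx]; exact: w_pos.
have wpq := w_pos _ _ spq hpq.
set a := dot w (rho s p q) in wpq pq_min; set b := dot v (rho s p q) in pq_min.
have v_h i j : h i j != 0 -> dot v (rho s i j) = 0 by move=> /bv E; rewrite dot_rho E mulr0.
have prop i j : a * dot v (rho s i j) = b * dot w (rho s i j).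
  apply/eqP; rewrite -subr_eq0 -dot_comb; apply/eqP.
  apply: prime_graph_extremal spq hpq _ i j.
  - move=> i j sij; rewrite dot_comb; have [hij|hij] := eqVneq (h i j) 0.
      have := pq_min (i, j); rewrite /Q sij hij eqxx => /(_ isT) /=.
      by rewrite subr_ge0 [a * _]mulrC.
    by rewrite v_h // w_h // !mulr0 subrr.
  - by move=> i j hij; rewrite dot_comb v_h // w_h // !mulr0 subrr.
  by rewrite dot_comb -/a -/b mulrC subrr.
have bw : balanced h w.
  move=> i j hij; have := w_h i j hij; rewrite dot_rho => /eqP.
  by rewrite mulf_eq0 (negPf (prime_graph_neq0 hij).1) /= => /eqP.
(* For [b = 0] the functional [v] vanishes on all edges of [s]. A removed edge at [C] would then
   stay in [C], where [w] is proportional to [v], and [w] would vanish on it. *)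
have [b0|nb0] := eqVneq b 0.
  case/negP: nC; apply: (comp_of_all prime_graph_sub Ch) => i j iC sij.
  apply/negP => /eqP hij; have := w_pos i j sij hij.
  have /eqP := prop i j; rewrite b0 mul0r mulf_eq0 gt_eqF //= dot_rho mulf_eq0 (negPf sij) /= => /eqP vij.
  have vj : v j = - v i by apply/eqP; rewrite -addr_eq0 addrC vij.
  have jC : j \in C by rewrite -vC vj oppr_eq0 vC.
  have := balanced_mul_const bv bw (_ : j \in compset h i).
  rewrite -(comps_mem hS Ch iC) jC => /(_ isT); rewrite vj mulNr => /eqP.
  have vi : v i != 0 by rewrite vC.
  rewrite eq_sym -addr_eq0 -mulrDr mulf_eq0 (negPf vi) /= => /eqP wij.
  by rewrite dot_rho wij mulr0 ltxx.
(* [eps] is the sign of [b]; the choice -1 exchanges [L] and [R]. *)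
have mk (eps : int) : eps = 1 \/ eps = -1 -> 0 < eps * b -> cut s h C (fun i => eps * v i).
  move=> Heps pos; split=> //.
  - by move=> i j /bv vij; rewrite -mulrDr vij mulr0.
  - by move=> i; rewrite mulf_eq0 -vC; case: Heps => ->.
  - by move=> i; have := v1 i; case: Heps => ->; rewrite ?mul1r // mulN1r; move: (v i) => x; clear; lia.
  move=> i j sij hij; rewrite -mulrDr mulrCA -dot_rho -(pmulr_rgt0 _ wpq) mulrCA prop mulrA.
  by rewrite mulr_gt0 // w_pos.
have [b_neg|b_pos] := ltrP b 0.
  by exists (fun i => -1 * v i); apply: mk; [right | rewrite mulN1r oppr_gt0].
by exists (fun i => 1 * v i); apply: mk; [left | rewrite mul1r lt_neqAle eq_sym nb0].
Qed.

(** On a removed edge [w] is positive, so it is nonzero at an endpoint. The component there is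
    bipartite, as [w] is balanced on [h], and it has lost this edge. *)
Lemma prime_graph_new : exists C, is_new s h C.
Proof.
have [w [w_h w_pos [p [q [spq hpq]]]]] := prime_graph_functional.
have hS := sub_sym prime_graph_sub.
have bw : balanced h w.
  move=> i j hij; have := w_h i j hij; rewrite dot_rho => /eqP.
  by rewrite mulf_eq0 (negPf (prime_graph_neq0 hij).1) /= => /eqP.
have mk i j : s i j != 0 -> h i j = 0 -> w i != 0 -> is_new s h (compset h i).
  move=> sij hij wi; rewrite /is_new mem_comps (balanced_bipartite hS bw wi) /=.
  apply/negP => /(comp_of_step sG) /(_ (compset_refl h i) sij) [_ E].
  by rewrite -E hij eqxx in sij.
have := w_pos p q spq hpq; rewrite dot_rho; have [wp|wp _] := eqVneq (w p) 0.
  have [->|wq _] := eqVneq (w q) 0; first by rewrite wp addr0 mulr0 ltxx.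
  exists (compset h q); apply: (mk q p) => //; first by rewrite (signed_sym sG).
  by rewrite (hS q p).
by exists (compset h p); exact: (mk p q).
Qed.

Lemma monomial_prime_principal :
  (forall h' : 'I_n -> 'I_n -> int, facet_subgraph s h' -> (ncomp h' <= (ncomp s).+1)%N) ->
  loc_principal P.
Proof.
move=> Hfac; have [C newC] := prime_graph_new; have [g Cg] := prime_graph_cuts newC.
have hsub := prime_graph_sub.
have cnt : (ncomp h <= (ncomp s).+1)%N.
  apply: Hfac; apply/(facet_subgraphP sG hsub); split; last exact: prime_graph_cuts.
  exact: (nbicomp_cuts sG hsub prime_graph_cuts newC).
have [_ [_ _ [p0 [q0 [s0 h0]]]]] := prime_graph_functional.
have [p [q [spq hpq pqgen]]] := cut_generator sG hsub Cg s0 h0 cnt.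
apply: (loc_principal_monomial eD Pp Pmon (Sr p q)); first exact: prime_graph_eq0.
move=> a Sa Pa; have [i [j [a' [Sa' sij hij ->]]]] := prime_edge Sa Pa.
have [t t0 [gt part]] := pqgen i j sij hij.
(* The group generated by the exponents outside [P], which are closed under addition because [P] is
   prime. *)
pose K a := exists c c', [/\ in_semigroup s c, in_semigroup s c', ~ P (e c), ~ P (e c') & a = c' - c].
have [|||||c [c' [Sc Sc' nc nc' E]]] :=
    cut_lattice sG hsub prime_graph_cuts Cg (K := K) _ _ _ _ _ gt part.
- by exists 0, 0; rewrite subrr e0; split; [exact: S0 | exact: S0 | exact: prime1 | exact: prime1 |].
- move=> b b' [c [c' [Sc Sc' nc nc' ->]]] [d [d' [Sd Sd' nd nd' ->]]]; exists (c + d), (c' + d').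
  split; [exact: SD | exact: SD | by rewrite eD //; exact: prime_notM
    | by rewrite eD //; exact: prime_notM|].
  by rewrite opprD addrACA.
- by move=> b [c [c' [Sc Sc' nc nc' ->]]]; exists c', c; rewrite opprB.
- move=> i' j' /prime_graph_neq0 [_ nP]; exists 0, (rho s i' j'); rewrite subr0 e0.
  by split; [exact: S0 | exact: Sr | exact: prime1 | |].
- by move=> v bv; rewrite dotD dotN dotMn !(balanced_dot _ _ bv) mul0r subr0.
(* One of the [t] copies of [rho s p q] is split off as the factor [e b], which is possible because
   [t] is positive. *)
exists c, (rho s p q *+ t.-1 + c' + a'); split=> //.
  by apply: SD => //; apply: SD => //; apply: SX; exact: Sr.
have -> : rho s i j = c' - c + rho s p q *+ t by rewrite -E subrK.
rewrite !addrA -mulrS prednK //.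
by rewrite [c' - c + _]addrC -!addrA [a' + c]addrC addKr.
Qed.

End MonomialPrime.

Lemma serre_R1_of_facets :
  (forall h : 'I_n -> 'I_n -> int, facet_subgraph s h -> (ncomp h <= (ncomp s).+1)%N) -> serre_R1 A.
Proof.
move=> H; apply/(serre_R1_min_prime SD eD e_free e_span) => P Pm.
have [Pmon|//] := min_prime_dichotomy S0 SD e0 eD e_free e_span Pm.
exact: monomial_prime_principal Pmon H.
Qed.

(** * The prime attached to a facet subgraph *)

Section FacetPrime.
Variable h : 'I_n -> 'I_n -> int.
Hypotheses (hsub : subgraph s h) (cuts : forall C, is_new s h C -> exists g, cut s h C g).
Variables (C : {set 'I_n}) (g : 'I_n -> int).
Hypothesis Cg : cut s h C g.

Let g_ge0 a : in_semigroup s a -> 0 <= dot g a.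
Proof. by apply: dot_semigroup_ge0 => // i j _; rewrite dot_rho (cut_ge0 sG hsub Cg). Qed.

(** Edges have nonnegative values and removed ones positive values, so a sum of value 0 uses edges
    of [h] only. *)
Lemma cut_zero_face (K : 'rV[int]_n -> Prop) a : in_semigroup s a -> dot g a = 0 -> K 0 ->
  (forall b c, K b -> K c -> K (b + c)) -> (forall i j, h i j != 0 -> K (rho s i j)) -> K a.
Proof.
move=> Sa ga K0 KD Kh; move: Sa ga.
apply: (in_semigroup_ind sG (K := fun a => dot g a = 0 -> K a)) => [|b c Sb Sc Hb Hc|i j sij] //.
  by rewrite dotD => E; have := g_ge0 Sb; have := g_ge0 Sc => gc gb; apply: KD; [apply: Hb | apply: Hc]; lia.
have [hij|hij _] := eqVneq (h i j) 0; last exact: Kh.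
by case: Cg => _ _ _ _ /(_ i j sij hij); rewrite -dot_rho => pos E; rewrite E ltxx in pos.
Qed.

(** Evenness of [a] and [t] satisfies the parity conditions of [cut_lattice], so the height is one
    whatever the number of components of [h]. *)
Lemma cut_min_prime p q : s p q != 0 -> h p q = 0 -> min_prime (face_ideal e_span (dot g)).
Proof.
move=> spq hpq.
pose gen b := exists i j, [/\ s i j != 0, h i j = 0 & b = rho s i j].
apply: (face_ideal_min_prime S0 SD e0 eD e_free e_span (gen := gen)).
- exact: dot_additive.
- exact: g_ge0.
- by move=> a; exact: dot_even.
- exists (rho s p q); first exact: Sr.
  by rewrite dot_rho gt_eqF //; case: Cg => _ _ _ _; apply.
- move=> _ [i [j [sij hij ->]]]; split; first exact: Sr.
    by rewrite dot_rho; case: Cg => _ _ _ _; apply.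
  by rewrite dot_rho (cut_val sG hsub Cg) //; case: (i \in C); case: (j \in C).
- move=> a; apply: (in_semigroup_ind sG (K := fun a => dot g a != 0 ->
      exists b a', [/\ gen b, in_semigroup s a' & a = b + a'])) => [|b c Sb Sc Hb Hc|i j sij].
  + by rewrite dot0 eqxx.
  + rewrite dotD; have [->|/Hb [d [a' [gd Sa' ->]]] _] := eqVneq (dot g b) 0.
      rewrite add0r => /Hc [d [a' [gd Sa' ->]]]; exists d, (b + a'); rewrite addrCA.
      by split=> //; exact: SD.
    by exists d, (a' + c); rewrite addrA; split=> //; exact: SD.
  have [hij _|hij] := eqVneq (h i j) 0; last by rewrite dot_rho (cut_val0 Cg hij) eqxx.
  by exists (rho s i j), 0; rewrite addr0; split=> //; exists i, j.
move=> a _ t Sa [i [j [sij hij ->]]] a_even ot ga.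
pose K a := exists c c', [/\ in_semigroup s c, in_semigroup s c', dot g c = 0, dot g c' = 0 & a = c' - c].
have [|||||||c [c' [Sc Sc' gc gc' E]]] :=
    cut_lattice sG hsub cuts Cg (K := K) (a := a - rho s i j *+ t).
- by exists 0, 0; rewrite subrr dot0; split=> //; exact: S0.
- move=> b b' [c [c' [Sc Sc' nc nc' ->]]] [d [d' [Sd Sd' nd nd' ->]]]; exists (c + d), (c' + d').
  by rewrite !dotD nc nc' nd nd'; split; [exact: SD | exact: SD | | | rewrite opprD addrACA].
- by move=> b [c [c' [Sc Sc' nc nc' ->]]]; exists c', c; rewrite opprB.
- move=> i' j' hij'; exists 0, (rho s i' j'); rewrite subr0 dot0 dot_rho (cut_val0 Cg hij').
  by split.
- move=> v bv; rewrite dotD dotN dotMn (balanced_dot _ _ bv) mul0r subr0.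
  exact: (balanced_dot_semigroup sG bv).
- by rewrite dotD dotN dotMn ga subrr.
- move=> D _ _; rewrite dotD rpredD //; first exact: dot_even.
  by rewrite dotN dotMn rpredN dvdz_mull //; lia.
by exists c, c'; split=> //; rewrite -[a](subrK (rho s i j *+ t)) E addrAC subrK addrC.
Qed.

(* u1 v1 and u2 v2 both have value 1 under g, but they differ in the parity of the sum over D1, which is even on
   the edges of h. *)
Lemma cut_not_principal : (ncomp s + 2 <= ncomp h)%N ->
  min_prime (face_ideal e_span (dot g)) /\ ~ loc_principal (face_ideal e_span (dot g)).
Proof.
move=> cnt.
have [D1 [D2 [u1 [v1 [u2 [v2 [[D1h D2h D1C D2C D12] [u1D v1C s1] [u2D v2C s2]]]]]]]] :=
  cut_leave_many sG hsub Cg cnt.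
have [Ch _ _ _ _] := Cg; have hS := sub_sym hsub.
have dis D E x : D \in comps h -> E \in comps h -> D != E -> x \in D -> (x \in E) = false.
  by move=> Dh Eh DE xD; apply: contraNF DE => xE; rewrite (comps_eq hS Dh Eh xD xE).
have cross D u v : D \in comps h -> D != C -> u \in D -> v \in C -> s u v != 0 -> h u v = 0.
  move=> Dh DC uD vC suv; apply/eqP/negPn/negP => huv.
  by have := comps_closed hS Dh huv; rewrite uD (dis C D) // eq_sym.
have h1 := cross _ _ _ D1h D1C u1D v1C s1; have h2 := cross _ _ _ D2h D2C u2D v2C s2.
split; first exact: cut_min_prime s1 h1.
pose d i : int := (i \in D1)%:R.
apply: (face_ideal_not_principal SD eD e_free (chi := fun a => ~~ (2 %| dot d a)%Z)
  (a1 := rho s u1 v1) (a2 := rho s u2 v2)).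
- exact: dot_additive.
- exact: g_ge0.
- by move=> a b; rewrite dotD odd_dvdzD.
- move=> a Sa ga; rewrite negbK.
  apply: (cut_zero_face (K := fun a => (2 %| dot d a)%Z) Sa ga).
  + by rewrite dot0.
  + by move=> b c; rewrite dotD => Hb Hc; exact: rpredD.
  move=> i j hij; rewrite dot_rho /d (comps_closed hS D1h hij).
  by rewrite dvdz_mull //; case: (j \in D1).
- exact: Sr.
- exact: Sr.
- by rewrite dot_rho (cut_val sG hsub Cg) // v1C (dis D1 C).
- by rewrite dot_rho (cut_val sG hsub Cg) // v2C (dis D2 C).
have CD1 : C != D1 by rewrite eq_sym.
have D21 : D2 != D1 by rewrite eq_sym.
rewrite !dot_rho /d u1D (dis C D1 v1) // (dis C D1 v2) // (dis D2 D1 u2) // addr0 mulr0.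
by have [->|->] := signed_val sG s1.
Qed.

End FacetPrime.

Lemma facets_of_serre_R1 h : serre_R1 A -> facet_subgraph s h -> (ncomp h <= (ncomp s).+1)%N.
Proof.
move=> R1 fac; have hsub : subgraph s h by case/and3P: fac.
have [Enb cuts] := iffLR (facet_subgraphP sG hsub) fac.
rewrite leqNgt; apply/negP => cnt.
(* Otherwise every bipartite component of [h] would be one of [s], against the count in the
   definition of a facet subgraph. *)
have [C newC] : exists C, is_new s h C.
  apply: contrapT => nex.
  suff : (nbicomp h <= nbicomp s)%N by rewrite Enb ltnn.
  apply: subset_leq_card; apply/subsetP => C; rewrite !inE => /andP[Ch bC].
  have Cold : comp_of s h C.
    by apply: contrapT => /negP nC; apply: nex; exists C; rewrite /is_new Ch bC.
  by rewrite (bipartite_comp_of sG Cold bC) andbT; case/andP: Cold.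
have [g Cg] := cuts C newC.
have [|Pm nP] := cut_not_principal hsub cuts Cg; first by rewrite addn2.
by apply: nP; apply: (iffLR (serre_R1_min_prime SD eD e_free e_span) R1).
Qed.

End EdgeRing.

Theorem mainTheorem6 (k : fieldType) (n : nat) (s : 'I_n -> 'I_n -> int)
    (A : comAlgType k) (e : 'rV[int]_n -> A) :
  signed_graph s -> is_edge_ring s e ->
  (serre_R1 A <->
   forall h : 'I_n -> 'I_n -> int, facet_subgraph s h -> (ncomp h <= (ncomp s).+1)%N).
Proof.
move=> sG He; split; last exact: serre_R1_of_facets sG He.
by move=> R1 h; exact: (facets_of_serre_R1 sG He R1).
Qed.
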